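(* Let $A \in \mathbb{R}^{m\times n}$ with $m \ge n$ have rank $n$, where $m$ is a power of $2$, and let $b \in \mathbb{R}^m$. Let $0<\varepsilon<1/3$, $0<\delta<1$, and $C\ge 1$ a constant. Let $\Theta$ be an $r\times m$ SRHT matrix with $r$ satisfying $$6C^2\varepsilon^{-1}\left[\sqrt{n} + \sqrt{8\ln(m/\delta)}\right]^2\ln(n/\delta) \le r \le m.$$ Let $x_{opt} = A^{+}b$ and $\tilde x_{opt} = (\Theta A)^{+}\Theta b$. Then, with probability at least $1 - \delta^{C^2\ln(n/\delta)/4} - 7\delta$, $$\|A\tilde x_{opt} - b\|_2 \le (1+22\varepsilon)\|A x_{opt} - b\|_2.$$ Furthermore, if $U_A \in \mathbb{R}^{m\times n}$ contains the left singular vectors of $A$ and there exists $\gamma\in(0,1]$ with $\|U_AU_A^T b\|_2 = \gamma\|b\|_2$, then with the same probability $$\|x_{opt} - \tilde x_{opt}\|_2 \le \left(\frac{1-\sqrt{\varepsilon}}{4\varepsilon}\right)^{1/2}\kappa(A)\sqrt{\gamma^{-2}-1}\;\|x_{opt}\|_2.$$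
   Context: Normalized Walsh–Hadamard matrix: for $N = 2^p$, $H_2 = \begin{pmatrix}1&1\\1&-1\end{pmatrix}$, $H_N = \begin{pmatrix} H_{N/2} & H_{N/2}\\ H_{N/2} & -H_{N/2}\end{pmatrix}$, and $H = N^{-1/2}H_N$. An $r\times N$ SRHT matrix ($N$ a power of 2) is $\Theta = \sqrt{N/r}\,RHD$ with $D$ an $N\times N$ diagonal matrix of independent uniform $\pm1$ signs, $H$ the normalized $N\times N$ Walsh–Hadamard matrix, and $R$ consisting of $r$ rows of $I_N$ chosen uniformly at random without replacement. $A^+$ is the Moore–Penrose pseudoinverse and $\kappa(A) = \|A\|_2\|A^+\|_2$ is the two-norm condition number. *)

(* Defs.v *)
From HB Require Import structures.
From mathcomp Require Export all_boot all_order all_algebra.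
From mathcomp Require Export boolp classical_sets reals sequences exp.

Set Implicit Arguments.
Unset Strict Implicit.
Unset Printing Implicit Defensive.

Import Order.TTheory GRing.Theory Num.Theory.
Local Open Scope ring_scope.

Section Norms.
Variable R : realType.

Definition norm2 (n : nat) (v : 'cV[R]_n) : R :=
  Num.sqrt (\sum_(i < n) v i 0 ^+ 2).

Definition specnorm (m n : nat) (A : 'M[R]_(m, n)) : R :=
  sup [set norm2 (A *m x) | x in [set x : 'cV[R]_n | norm2 x <= 1]]%classic.

(* The four Penrose equations. *)
Definition is_pseudoinverse (m n : nat) (A : 'M[R]_(m, n)) (X : 'M[R]_(n, m)) :
    Prop :=
  [/\ A *m X *m A = A, X *m A *m X = X,
      (A *m X)^T = A *m X & (X *m A)^T = X *m A].

(* The default value 0 of xget is never used: see pseudoinverseP.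
   (mathcomp's pinvmx is only a generalized inverse, not the Moore-Penrose
   one.) *)
Definition pseudoinverse (m n : nat) (A : 'M[R]_(m, n)) : 'M[R]_(n, m) :=
  xget 0 [set X | is_pseudoinverse A X]%classic.

Definition cond2 (m n : nat) (A : 'M[R]_(m, n)) : R :=
  specnorm A * specnorm (pseudoinverse A).

(* U is the left factor of a thin singular value decomposition
   A = U * diag(s) * V^T; the singular values may come in any order. *)
Definition left_singular_vectors (m n : nat) (A U : 'M[R]_(m, n)) : Prop :=
  exists (s : 'rV[R]_n) (V : 'M[R]_n),
    [/\ U^T *m U = 1%:M, V^T *m V = 1%:M, forall i, 0 <= s 0 i
      & A = U *m diag_mx s *m V^T].

Lemma gram_unit (m n : nat) (F : 'M[R]_(m, n)) :
  \rank F = n -> F^T *m F \in unitmx.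
Proof.
move=> rF; rewrite -row_free_unit -kermx_eq0; apply/eqP/row_matrixP => i.
rewrite row0; set u := row i _.
have hu : u *m (F^T *m F) = 0 by apply/sub_kermxP; exact: row_sub.
have huF : u *m F^T = 0.
  have h : (u *m F^T) *m (u *m F^T)^T = 0.
    by rewrite trmx_mul trmxK mulmxA -(mulmxA u) hu mul0mx.
  apply/rowP => j; rewrite [RHS]mxE.
  have := congr1 (fun M : 'M_1 => M 0 0) h; rewrite !mxE => /eqP.
  rewrite psumr_eq0; last first.
    by move=> k _; rewrite [_^T _ _]mxE -expr2 sqr_ge0.
  move=> /allP /(_ j); rewrite mem_index_enum => /(_ isT) /=.
  by rewrite [_^T _ _]mxE -expr2 sqrf_eq0 => /eqP; rewrite mxE.
have rfF : row_free F^T by rewrite /row_free mxrank_tr rF.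
by apply: (row_free_inj rfF); rewrite huF mul0mx.
Qed.

Lemma pseudoinverseP (m n : nat) (A : 'M[R]_(m, n)) :
  is_pseudoinverse A (pseudoinverse A).
Proof.
suff [X hX] : exists X, is_pseudoinverse A X.
  exact: (xgetPex 0 (ex_intro _ X hX)).
have [k [F [G [AE rF rG]]]] : exists k (F : 'M[R]_(m, k)) (G : 'M[R]_(k, n)),
    [/\ A = F *m G, \rank F = k & \rank G = k].
  exists (\rank A), (col_base A), (row_base A); split.
  - by rewrite mulmx_base.
  - by apply/eqP; exact: col_base_full.
  - by apply/eqP; exact: row_base_free.
have uF : F^T *m F \in unitmx by exact: gram_unit.
have uG : G *m G^T \in unitmx.
  by rewrite -{1}[G]trmxK; apply: gram_unit; rewrite mxrank_tr.
set P := invmx (F^T *m F); set Q := invmx (G *m G^T).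
have PT : P^T = P by rewrite /P trmx_inv trmx_mul trmxK.
have QT : Q^T = Q by rewrite /Q trmx_inv trmx_mul trmxK.
have AX : A *m (G^T *m Q *m P *m F^T) = F *m P *m F^T.
  rewrite AE -!mulmxA; congr (F *m _).
  by rewrite !mulmxA mulmxV // mul1mx.
have XA : (G^T *m Q *m P *m F^T) *m A = G^T *m Q *m G.
  by rewrite AE mulmxA -(mulmxA _ F^T F) -(mulmxA _ P) mulVmx // mulmx1.
exists (G^T *m Q *m P *m F^T); split.
- by rewrite AX AE mulmxA -(mulmxA _ F^T F) -(mulmxA _ P) mulVmx // mulmx1.
- rewrite XA !mulmxA -(mulmxA _ G) -(mulmxA (G^T *m Q)).
  by rewrite mulmxV // mulmx1.
- by rewrite AX !trmx_mul trmxK PT mulmxA.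
- by rewrite XA !trmx_mul trmxK QT mulmxA.
Qed.

Lemma pseudoinverse_uniq (m n : nat) (A : 'M[R]_(m, n)) X Y :
  is_pseudoinverse A X -> is_pseudoinverse A Y -> X = Y.
Proof.
move=> [x1 x2 x3 x4] [y1 y2 y3 y4].
have e1 : A *m X = A *m Y.
  by rewrite -{1}y1 -mulmxA -x3 -{1}y3 -trmx_mul mulmxA x1 y3.
have e2 : X *m A = Y *m A.
  rewrite -{1}y1 -mulmxA mulmxA -x4 -{1}y4 -trmx_mul.
  by rewrite -mulmxA (mulmxA A) x1 y4.
by rewrite -x2 e2 -mulmxA e1 mulmxA y2.
Qed.

End Norms.

Section SRHT.
Variable R : realType.

Lemma double_pow2 (p : nat) : (2 ^ p + 2 ^ p = 2 ^ p.+1)%N.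
Proof. by rewrite expnS mul2n addnn. Qed.

Fixpoint hadamard (p : nat) : 'M[R]_(2 ^ p) :=
  match p with
  | 0 => 1%:M
  | q.+1 => castmx (double_pow2 q, double_pow2 q)
      (block_mx (hadamard q) (hadamard q) (hadamard q) (- hadamard q))
  end.

Definition normalized_hadamard (p : nat) : 'M[R]_(2 ^ p) :=
  (Num.sqrt (2 ^ p)%:R)^-1 *: hadamard p.

(* An outcome (d, s): the sign of the j-th diagonal entry of D is (-1)^(d j),
   and the i-th row of the sampling matrix is row s i of the identity. *)
Definition srht_outcome (r N : nat) : Type :=
  ({ffun 'I_N -> bool} * {ffun 'I_r -> 'I_N})%type.

(* Sampling without replacement: s is injective. *)
Definition srht_space (r N : nat) : {set srht_outcome r N} :=
  [set w : srht_outcome r N | injectiveb w.2].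

(* Uniform probability on srht_space, so that the signs are independent and
   uniform, and independent of the uniformly chosen rows. *)
Definition srht_prob (r N : nat) (E : pred (srht_outcome r N)) : R :=
  #|[set w in srht_space r N | E w]|%:R / #|srht_space r N|%:R.

Definition sign_mx (N : nat) (d : {ffun 'I_N -> bool}) : 'M[R]_N :=
  diag_mx (\row_j (-1) ^+ d j).

Definition sampling_mx (r N : nat) (s : {ffun 'I_r -> 'I_N}) : 'M[R]_(r, N) :=
  rowsub s 1%:M.

Definition srht (r p : nat) (w : srht_outcome r (2 ^ p)) : 'M[R]_(r, 2 ^ p) :=
  Num.sqrt ((2 ^ p)%:R / r%:R) *:
    (sampling_mx w.2 *m normalized_hadamard p *m sign_mx w.1).

End SRHT.

(* Main.v *)
Require Import Defs.
From mathcomp Require Import all_boot all_order all_algebra perm.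
From mathcomp Require Import boolp classical_sets functions reals topology normedtype.
From mathcomp Require Import sequences exp convex spectral complex interval_inference ring lra.

(** Let the columns of [W] be an orthonormal basis of the span of the columns of
[A] and [b], so that [W] has at most [n + 1] columns.  If the Gram matrix of
[Theta W] differs from the identity by at most [eta] as a quadratic form, then
the normal equations of both problems give
[|A (x~ - x)|^2 <= eta^2 / (1 - eta^2) |A x - b|^2], and both claims follow with
[eta^2 = 2 eps / 3].

The near-isometry holds outside an event of probability [5 delta].  For random
signs, the squared norm of a row of [H D W] has exponential moments of chi-square
type, as one sees by integrating out the signs one at a time; this bounds all the
rows simultaneously.  For such signs, the Gram matrix is a sum of [r] rank-one
matrices drawn without replacement, and its trace exponential is controlled one
draw at a time by the Golden--Thompson inequality for a perturbation of rank one.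
That inequality is proved for traces of powers, by comparing words in [A] and
[v v^T] in a cone inside the nonnegative orthant of the Lanczos basis of [v]. *)

Set Implicit Arguments.
Unset Strict Implicit.
Unset Printing Implicit Defensive.

Import Order.TTheory GRing.Theory Num.Theory.
Import numFieldNormedType.Exports.
Local Open Scope ring_scope.

(** * Finite sums and quadratic forms *)

Lemma sum_ord_ltS (V : nmodType) n (F : 'I_n -> V) (k : 'I_n) :
  \sum_(i < n | (i < k.+1)%N) F i = \sum_(i < n | (i < k)%N) F i + F k.
Proof.
rewrite (bigD1 k) ?ltnS //= addrC; congr (_ + _).
by apply: eq_bigl => i; rewrite ltnS -val_eqE /= ltn_neqAle andbC.
Qed.

Lemma card_le_sum (R : numDomainType) (I : finType) (P Q : pred I) (f : I -> R) :
  (forall i, P i -> 0 <= f i) -> (forall i, P i -> Q i -> 1 <= f i) ->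
  #|[set i | P i & Q i]|%:R <= \sum_(i | P i) f i.
Proof.
move=> f_ge0 f_ge1; rewrite -sum1_card natr_sum big_mkcond [leRHS]big_mkcond /=.
apply: ler_sum => i _; rewrite inE; have [Pi|//] := boolP (P i).
by have [Qi|_] := boolP (Q i); [exact: f_ge1 | exact: f_ge0].
Qed.

Lemma card_exists_le (I J : finType) (B : I -> pred J) :
  (#|[set i | [exists j, B i j]]| <= \sum_j #|[set i | B i j]|)%N.
Proof.
rewrite (_ : [set i | _] = \bigcup_j [set i | B i j]); last first.
  apply/setP => i; rewrite inE; apply/existsP/bigcupP => [[j Bij]|[j _]].
    by exists j; rewrite ?inE.
  by rewrite inE; exists j.
apply: (big_ind2 (fun (S : {set I}) k => (#|S| <= k)%N)) => [|S k S' k' S_le S'_le|//].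
  by rewrite cards0.
exact: leq_trans (leq_card_setU _ _) (leq_add S_le S'_le).
Qed.

Section Dot.
Variable R : comNzRingType.

Definition dot n (u v : 'cV[R]_n) : R := \sum_i u i 0 * v i 0.

Definition outer n (v : 'cV[R]_n) : 'M[R]_n := v *m v^T.

Definition gram m n (M : 'M[R]_(m, n)) : 'M[R]_n := M^T *m M.

Lemma dot_mulmx_tr n m (B : 'M[R]_(n, m)) y x : dot x (B *m y) = dot (B^T *m x) y.
Proof.
have dotE k (u v : 'cV[R]_k) : dot u v = (u^T *m v) 0 0.
  by rewrite mxE; apply: eq_bigr => i _; rewrite mxE.
by rewrite !dotE trmx_mul trmxK mulmxA.
Qed.

Variable n : nat.
Implicit Types (u v w x : 'cV[R]_n) (A : 'M[R]_n).

Lemma dotC u v : dot u v = dot v u.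
Proof. by apply: eq_bigr => i _; rewrite mulrC. Qed.

Lemma dotDr u v w : dot u (v + w) = dot u v + dot u w.
Proof. by rewrite -big_split; apply: eq_bigr => i _; rewrite mxE mulrDr. Qed.

Lemma dotDl u v w : dot (u + v) w = dot u w + dot v w.
Proof. by rewrite !(dotC _ w) dotDr. Qed.

Lemma dotZr a u v : dot u (a *: v) = a * dot u v.
Proof. by rewrite mulr_sumr; apply: eq_bigr => i _; rewrite mxE mulrCA. Qed.

Lemma dotZl a u v : dot (a *: u) v = a * dot u v.
Proof. by rewrite dotC dotZr dotC. Qed.

Lemma dotNr u v : dot u (- v) = - dot u v.
Proof. by rewrite -scaleN1r dotZr mulN1r. Qed.

Lemma dotNl u v : dot (- u) v = - dot u v.
Proof. by rewrite dotC dotNr dotC. Qed.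

Lemma dotBr u v w : dot u (v - w) = dot u v - dot u w.
Proof. by rewrite dotDr dotNr. Qed.

Lemma dotBl u v w : dot (u - v) w = dot u w - dot v w.
Proof. by rewrite dotDl dotNl. Qed.

Lemma dot0r u : dot u 0 = 0.
Proof. by rewrite -(scale0r 0) dotZr mul0r. Qed.

Lemma dot0l u : dot 0 u = 0.
Proof. by rewrite dotC dot0r. Qed.

Lemma dot_sumr I (r : seq I) (P : pred I) u (F : I -> 'cV[R]_n) :
  dot u (\sum_(i <- r | P i) F i) = \sum_(i <- r | P i) dot u (F i).
Proof. by apply: (big_morph (dot u)) => [v w|]; rewrite ?dotDr ?dot0r. Qed.

Lemma dotD_orth u v : dot u v = 0 -> dot (u + v) (u + v) = dot u u + dot v v.
Proof. by move=> uv; rewrite !(dotDl, dotDr) (dotC v u) uv addr0 add0r. Qed.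

Lemma dot_symD A x u : A^T = A ->
  dot (x + u) (A *m (x + u)) = dot x (A *m x) + dot u (A *m u) + 2 * dot u (A *m x).
Proof.
move=> symA; have uAx : dot x (A *m u) = dot u (A *m x).
  by rewrite dot_mulmx_tr symA dotC.
by rewrite mulmxDr !(dotDl, dotDr) uAx; ring.
Qed.

Lemma outerZ a v : outer (a *: v) = a ^+ 2 *: outer v.
Proof.
have -> : outer (a *: v) = (a *: v) *m (a *: v^T) by rewrite /outer linearZ.
by rewrite -scalemxAl -scalemxAr scalerA expr2.
Qed.

Lemma tr_outer v : (outer v)^T = outer v.
Proof. by rewrite trmx_mul trmxK. Qed.

Lemma mul_outer v u : outer v *m u = dot v u *: v.
Proof.
apply/colP => i; rewrite -mulmxA !mxE big_ord1 mulrC !mxE.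
by congr (_ * _); apply: eq_bigr => j _; rewrite mxE.
Qed.

Lemma dot_outer v u : dot u (outer v *m u) = dot v u ^+ 2.
Proof. by rewrite mul_outer dotZr (dotC u) expr2. Qed.

Lemma mxtrace_mul_outer A v : \tr (A *m outer v) = dot v (A *m v).
Proof.
rewrite mulmxA mxtrace_mulC /mxtrace big_ord1 mxE.
by apply: eq_bigr => i _; rewrite mxE.
Qed.

Lemma mxtrace_outer v : \tr (outer v) = dot v v.
Proof. by rewrite -[outer v]mul1mx mxtrace_mul_outer mul1mx. Qed.

Lemma sum_outer_row m (M : 'M[R]_(m, n)) : \sum_i outer (row i M)^T = gram M.
Proof.
apply/matrixP => i j; rewrite summxE mxE; apply: eq_bigr => k _.
by rewrite mxE big_ord1 !mxE.
Qed.

Lemma tr_gram m (M : 'M[R]_(m, n)) : (gram M)^T = gram M.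
Proof. by rewrite trmx_mul trmxK. Qed.

Lemma gram_mulmx m k (M : 'M[R]_(m, k)) (N : 'M[R]_(k, n)) :
  gram (M *m N) = N^T *m gram M *m N.
Proof. by rewrite /gram trmx_mul !mulmxA. Qed.

Lemma dot_orthonormal m (W : 'M[R]_(m, n)) x y :
  gram W = 1%:M -> dot (W *m x) (W *m y) = dot x y.
Proof. by move=> orthW; rewrite dot_mulmx_tr mulmxA -[_ *m W]/(gram W) orthW mul1mx. Qed.

Lemma gramZ m a (M : 'M[R]_(m, n)) : gram (a *: M) = a ^+ 2 *: gram M.
Proof.
by rewrite -!sum_outer_row scaler_sumr; apply: eq_bigr => i _; rewrite -outerZ -!linearZ.
Qed.

End Dot.

Section PositiveForms.
Variables (R : realDomainType) (n : nat).
Implicit Types (u v x : 'cV[R]_n) (A : 'M[R]_n).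

Definition psd A : Prop := A^T = A /\ forall x, 0 <= dot x (A *m x).

Lemma dot_ge0 u : 0 <= dot u u.
Proof. by apply: sumr_ge0 => i _; rewrite -expr2 sqr_ge0. Qed.

Lemma dot_eq0 u : (dot u u == 0) = (u == 0).
Proof.
apply/eqP/eqP => [/eqP|->]; last exact: dot0r.
rewrite psumr_eq0 => [/allP u0|i _]; last by rewrite -expr2 sqr_ge0.
apply/colP => i; rewrite mxE; apply/eqP.
by have /implyP := u0 i (mem_index_enum i); rewrite -expr2 sqrf_eq0; apply.
Qed.

Lemma dot_gt0 u : (0 < dot u u) = (u != 0).
Proof. by rewrite lt_def dot_ge0 dot_eq0 andbT. Qed.

Lemma dot_CauchySchwarz u v : dot u v ^+ 2 <= dot u u * dot v v.
Proof.
have [->|v_neq0] := eqVneq v 0; first by rewrite !dot0r expr0n mulr0.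
rewrite -(ler_pM2l (_ : 0 < dot v v)) ?dot_gt0 //.
rewrite -subr_ge0; have := dot_ge0 (dot v v *: u - dot u v *: v).
by rewrite !(dotBl, dotBr, dotZl, dotZr) (dotC v u); congr (0 <= _); ring.
Qed.

Lemma psd_outer v : psd (outer v).
Proof. by split=> [|x]; rewrite ?tr_outer // dot_outer sqr_ge0. Qed.

Lemma psd_sum_outer (I : finType) (P : pred I) (a : I -> 'cV[R]_n) :
  psd (\sum_(i | P i) outer (a i)).
Proof.
split; first by rewrite linear_sum; apply: eq_bigr => i _; exact: tr_outer.
by move=> x; rewrite mulmx_suml dot_sumr sumr_ge0 // => i _; exact: (psd_outer _).2.
Qed.

Lemma psd_gram m (M : 'M[R]_(m, n)) : psd (gram M).
Proof. by rewrite -sum_outer_row; exact: psd_sum_outer. Qed.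

End PositiveForms.

(** * Traces of powers of rank-one perturbations *)

Section LanczosCone.
Variables (R : realFieldType) (n : nat) (v : 'cV[R]_n) (C : 'M[R]_n).
Implicit Types (u w : 'cV[R]_n) (M N : 'M[R]_n).

Definition orth_compl : 'M[R]_n := (dot v v)%:M - outer v.

Definition lanczos k : 'cV[R]_n := (orth_compl *m C) ^+ k *m v.

(* In the Lanczos basis of [v] this cone lies in the nonnegative orthant, on
   which [C], [orth_compl] and [outer v] act by entrywise nonnegative matrices. *)
Inductive lanczos_cone : 'cV[R]_n -> Prop :=
| lanczos_cone0 : lanczos_cone 0
| lanczos_coneDZ c k w :
    0 <= c -> lanczos_cone w -> lanczos_cone (w + c *: lanczos k).

Definition cone_map M := forall w, lanczos_cone w -> lanczos_cone (M *m w).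

Lemma lanczos_cone_lanczosZ c k : 0 <= c -> lanczos_cone (c *: lanczos k).
Proof. by move=> c_ge0; rewrite -[_ *: _]add0r; apply: lanczos_coneDZ => //; constructor. Qed.

Lemma lanczos_coneD u w : lanczos_cone u -> lanczos_cone w -> lanczos_cone (u + w).
Proof.
move=> Ku; elim => [|c k w' c_ge0 _ IH]; first by rewrite addr0.
by rewrite addrA; apply: lanczos_coneDZ.
Qed.

Lemma lanczos_coneZ a w : 0 <= a -> lanczos_cone w -> lanczos_cone (a *: w).
Proof.
move=> a_ge0; elim => [|c k w' c_ge0 _ IH]; first by rewrite scaler0; constructor.
by rewrite scalerDr scalerA; apply: lanczos_coneDZ => //; apply: mulr_ge0.
Qed.

Lemma cone_map_lanczos M : (forall k, lanczos_cone (M *m lanczos k)) -> cone_map M.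
Proof.
move=> M_lanczos w; elim => [|c k w' c_ge0 _ IH]; first by rewrite mulmx0; constructor.
by rewrite mulmxDr -scalemxAr; apply: lanczos_coneD => //; apply: lanczos_coneZ.
Qed.

Lemma cone_mapD M N : cone_map M -> cone_map N -> cone_map (M + N).
Proof. by move=> M_cone N_cone w Kw; rewrite mulmxDl; apply: lanczos_coneD; auto. Qed.

Lemma cone_mapZ a M : 0 <= a -> cone_map M -> cone_map (a *: M).
Proof. by move=> a_ge0 M_cone w Kw; rewrite -scalemxAl; apply: lanczos_coneZ; auto. Qed.

Lemma cone_map_scalar a : 0 <= a -> cone_map a%:M.
Proof. by move=> a_ge0 w Kw; rewrite mul_scalar_mx; apply: lanczos_coneZ. Qed.

Lemma cone_mapX M k : cone_map M -> cone_map (M ^+ k).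
Proof.
move=> M_cone; elim: k => [|k IH] w Kw; first by rewrite expr0 mul1mx.
by rewrite exprS -mulmxA; apply: M_cone; apply: IH.
Qed.

Lemma cone_mapB_expr M N k : cone_map M -> cone_map N -> cone_map ((M + N) ^+ k - M ^+ k).
Proof.
move=> M_cone N_cone; elim: k => [|k IH] w Kw.
  by rewrite subrr mul0mx; constructor.
have -> : (M + N) ^+ k.+1 - M ^+ k.+1
    = M *m ((M + N) ^+ k - M ^+ k) + N *m (M + N) ^+ k.
  by rewrite mulmxBr !exprS -[(M + N) * _]/((M + N) *m _) mulmxDl addrAC.
rewrite mulmxDl -!mulmxA; apply: lanczos_coneD; first exact/M_cone/IH.
exact/N_cone/(cone_mapX k (cone_mapD M_cone N_cone)).
Qed.

Lemma lanczos0 : lanczos 0 = v.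
Proof. by rewrite /lanczos expr0 mul1mx. Qed.

Lemma lanczosS k : lanczos k.+1 = orth_compl *m (C *m lanczos k).
Proof. by rewrite /lanczos exprS -!mulmxA. Qed.

Lemma lanczos_cone_base : lanczos_cone v.
Proof. by rewrite -lanczos0 -[lanczos 0]scale1r; apply: lanczos_cone_lanczosZ. Qed.

Lemma mul_orth_compl w : orth_compl *m w = dot v v *: w - dot v w *: v.
Proof. by rewrite mulmxBl mul_scalar_mx mul_outer. Qed.

Lemma psd_orth_compl : psd orth_compl.
Proof.
split; first by rewrite linearB /= tr_scalar_mx tr_outer.
move=> x; rewrite mul_orth_compl dotBr !dotZr (dotC x v) -expr2 subr_ge0.
exact: dot_CauchySchwarz.
Qed.

Lemma dot_lanczosS k : dot v (lanczos k.+1) = 0.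
Proof. by rewrite lanczosS mul_orth_compl dotBr !dotZr mulrC subrr. Qed.

Lemma dot_cone_ge0 w : lanczos_cone w -> 0 <= dot v w.
Proof.
elim => [|c [|k] w' c_ge0 _ IH]; rewrite ?dot0r // dotDr dotZr addr_ge0 //.
  by rewrite lanczos0 mulr_ge0 // dot_ge0.
by rewrite dot_lanczosS mulr0.
Qed.

Lemma cone_map_orth_compl : cone_map orth_compl.
Proof.
apply: cone_map_lanczos => -[|k]; rewrite mul_orth_compl.
  by rewrite lanczos0 subrr; constructor.
by rewrite dot_lanczosS scale0r subr0; apply: lanczos_cone_lanczosZ; apply: dot_ge0.
Qed.

Lemma cone_map_outer : cone_map (outer v).
Proof.
move=> w Kw; rewrite mul_outer.
by apply: lanczos_coneZ; [exact: dot_cone_ge0 | exact: lanczos_cone_base].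
Qed.

Lemma cone_map_scalarB_outer b : dot v v <= b -> cone_map (b%:M - outer v).
Proof.
move=> v_le; have -> : b%:M - outer v = (b - dot v v)%:M + orth_compl.
  by rewrite /orth_compl raddfB /= addrA subrK.
apply: cone_mapD cone_map_orth_compl.
by apply: cone_map_scalar; rewrite subr_ge0.
Qed.

Lemma dot_mul_expr_cone_le D M N i j : cone_map D -> cone_map M -> cone_map N ->
  dot v (D ^+ j *m (M ^+ i *m v)) <= dot v (D ^+ j *m ((M + N) ^+ i *m v)).
Proof.
move=> D_cone M_cone N_cone; rewrite -subr_ge0 -dotBr -mulmxBr -mulmxBl.
apply: dot_cone_ge0; apply: (cone_mapX j D_cone).
exact: cone_mapB_expr i M_cone N_cone _ lanczos_cone_base.
Qed.

Hypothesis psdC : psd C.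

Lemma dot_lanczos_shift i j :
  dot (C *m lanczos i) (lanczos j) = dot v (C *m lanczos (i + j)).
Proof.
elim: i j => [|i IH] j; first by rewrite lanczos0 add0n [RHS]dot_mulmx_tr psdC.1.
rewrite addSnnS -IH !lanczosS (dotC _ (lanczos j)) dot_mulmx_tr psdC.1.
by rewrite dot_mulmx_tr psd_orth_compl.1 dotC.
Qed.

Lemma dot_mul_lanczos_ge0 k : 0 <= dot v (C *m lanczos k).
Proof.
rewrite -(odd_double_half k) -addnn; case: (odd k) => /=; last first.
  by rewrite add0n -dot_lanczos_shift dotC psdC.2.
by rewrite add1n -addnS -dot_lanczos_shift lanczosS psd_orth_compl.2.
Qed.

Lemma cone_map_psd : cone_map C.
Proof.
apply: cone_map_lanczos => k; have [v0|v_neq0] := eqVneq v 0.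
  by rewrite /lanczos v0 !mulmx0; constructor.
have v_gt0 : 0 < dot v v by rewrite dot_gt0.
have -> : C *m lanczos k = (dot v v)^-1 *: lanczos k.+1
    + ((dot v v)^-1 * dot v (C *m lanczos k)) *: lanczos 0.
  rewrite lanczosS mul_orth_compl lanczos0 -scalerA -scalerDr subrK.
  by rewrite scalerA mulVf ?scale1r // gt_eqF.
have vV_ge0 : 0 <= (dot v v)^-1 by rewrite invr_ge0 dot_ge0.
apply: lanczos_coneD; apply: lanczos_cone_lanczosZ => //.
by rewrite mulr_ge0 // dot_mul_lanczos_ge0.
Qed.

End LanczosCone.

Lemma exprD_sub_telescope (R : pzRingType) (a x : R) k :
  (a + x) ^+ k - a ^+ k = \sum_(i < k) (a + x) ^+ i * x * a ^+ (k.-1 - i).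
Proof.
case: k => [|k]; first by rewrite big_ord0 subrr.
transitivity (\sum_(0 <= i < k.+1)
    ((a + x) ^+ i.+1 * a ^+ (k.+1 - i.+1) - (a + x) ^+ i * a ^+ (k.+1 - i))).
  by rewrite telescope_sumr // subnn subn0 !expr0 mulr1 mul1r.
rewrite big_mkord; apply: eq_bigr => i _.
rewrite subSS (subSn (leq_ord i)) exprSr [a ^+ _.+1]exprS !mulrA -mulrBl -mulrBr.
by rewrite addrAC subrr add0r.
Qed.

Section TracePower.
Variables (R : realFieldType) (n : nat).
Implicit Types (A : 'M[R]_n) (v : 'cV[R]_n).

Lemma trace_exprD_outer A v th k :
  \tr ((A + th *: outer v) ^+ k) - \tr (A ^+ k)
    = th * \sum_(i < k) dot v (A ^+ (k.-1 - i) *m ((A + th *: outer v) ^+ i *m v)).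
Proof.
rewrite -linearB /= exprD_sub_telescope raddf_sum mulr_sumr; apply: eq_bigr => i _.
rewrite -[_ * _ * _]/(_ *m _ *m _) -scalemxAr -scalemxAl /= mxtraceZ.
by rewrite mxtrace_mulC mulmxA mxtrace_mul_outer mulmxA.
Qed.

Lemma dot_exprD_scalar A v b k :
  dot v ((A + b%:M) ^+ k *m v) - dot v (A ^+ k *m v)
    = b * \sum_(i < k) dot v (A ^+ (k.-1 - i) *m ((A + b%:M) ^+ i *m v)).
Proof.
rewrite -dotBr -mulmxBl exprD_sub_telescope mulmx_suml dot_sumr mulr_sumr.
apply: eq_bigr => i _; rewrite -[_ * _ * _]/(_ *m b%:M *m _).
rewrite mul_mx_scalar -!scalemxAl dotZr mulmxA; congr (_ * dot v (_ *m v)).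
apply: commrX; apply: commr_sym; apply: commrX.
by apply: commrD => //; exact: scalar_mxC.
Qed.

(* Both sides are sums of terms [v^T A^j B^i v]; they are compared one by one. *)
Lemma trace_exprD_outer_le A v (th b : R) k :
  dot v v <= b -> 0 < b -> psd A -> psd (A + (th * b)%:M) ->
  \tr ((A + th *: outer v) ^+ k) <= \tr (A ^+ k)
    + b^-1 * (dot v ((A + (th * b)%:M) ^+ k *m v) - dot v (A ^+ k *m v)).
Proof.
move=> v_le b_gt0 psdA psdC.
rewrite dot_exprD_scalar -lerBlDl trace_exprD_outer.
rewrite mulrA [b^-1 * _]mulrCA mulVf ?gt_eqF // mulr1 !mulr_sumr.
apply: ler_sum => i _.
set B := A + th *: _; set C := A + _%:M.
have CB : C = B + th *: (b%:M - outer v).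
  by rewrite /B /C scalerBr -addrA [_ *: _ + (_ - _)]addrC subrK scale_scalar_mx.
have [th_ge0|th_lt0] := leP 0 th.
- rewrite ler_wpM2l // CB; apply: (@dot_mul_expr_cone_le _ _ _ A).
  + exact: cone_map_psd.
  + apply: cone_mapD; first exact: cone_map_psd.
    by apply: cone_mapZ => //; exact: cone_map_outer.
  + by apply: cone_mapZ => //; exact: cone_map_scalarB_outer.
- rewrite ler_wnM2l ?(ltW th_lt0) //.
  have Nth_ge0 : 0 <= - th by rewrite oppr_ge0 ltW.
  have -> : B = C + (- th) *: (b%:M - outer v) by rewrite CB scaleNr addrK.
  apply: (@dot_mul_expr_cone_le _ _ _ C).
  + have -> : A = C + (- th * b)%:M by rewrite /C mulNr raddfN /= addrK.
    apply: cone_mapD; first exact: cone_map_psd.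
    by apply: cone_map_scalar; rewrite mulr_ge0 // ltW.
  + exact: cone_map_psd.
  + by apply: cone_mapZ => //; exact: cone_map_scalarB_outer.
Qed.

End TracePower.

(** * Diagonalization of real symmetric matrices *)

Section SpectralDecomp.
Variables (R : realFieldType) (n : nat).

Definition spectral_decomp (A P : 'M[R]_n) (l : 'rV[R]_n) : Prop :=
  P^T *m P = 1%:M /\ A = P^T *m diag_mx l *m P.

Variables (A P : 'M[R]_n) (l : 'rV[R]_n).
Hypothesis decA : spectral_decomp A P l.
Implicit Types (v : 'cV[R]_n) (k : nat).

Lemma spectral_decomp_mulmx_tr : P *m P^T = 1%:M.
Proof. exact/mulmx1C/decA.1. Qed.

Lemma spectral_decomp_diag : P *m A *m P^T = diag_mx l.
Proof.
rewrite decA.2 !mulmxA spectral_decomp_mulmx_tr mul1mx -mulmxA.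
by rewrite spectral_decomp_mulmx_tr mulmx1.
Qed.

Lemma spectral_decomp_affine c e :
  spectral_decomp (c *: A + e%:M) P (\row_i (c * l 0 i + e)).
Proof.
split; first exact: decA.1.
have -> : diag_mx (\row_i (c * l 0 i + e)) = c *: diag_mx l + e%:M.
  by apply/matrixP => i j; rewrite !mxE mulrnDl mulrnAr.
rewrite mulmxDr mulmxDl -scalemxAr -scalemxAl -decA.2 mul_mx_scalar -scalemxAl.
by rewrite decA.1 scalemx1.
Qed.

Lemma spectral_decompZ c : spectral_decomp (c *: A) P (c *: l).
Proof.
have := spectral_decomp_affine c 0; rewrite raddf0 addr0.
by rewrite (_ : \row_i _ = c *: l) //; apply/rowP => i; rewrite !mxE addr0.
Qed.

Lemma spectral_decomp_expr k : A ^+ k = P^T *m diag_mx (\row_i l 0 i ^+ k) *m P.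
Proof.
elim: k => [|k IH].
  have -> : \row_i l 0 i ^+ 0 = const_mx 1 by apply/rowP => i; rewrite !mxE.
  by rewrite diag_const_mx mulmx1 decA.1.
rewrite exprS IH {1}decA.2 -[LHS]/(_ *m _) !mulmxA -(mulmxA _ P) spectral_decomp_mulmx_tr.
rewrite mulmx1 -(mulmxA P^T) mulmx_diag; congr (_ *m diag_mx _ *m _).
by apply/rowP => i; rewrite !mxE exprS.
Qed.

Lemma mxtrace_expr_spectral k : \tr (A ^+ k) = \sum_i l 0 i ^+ k.
Proof.
rewrite spectral_decomp_expr -mulmxA mxtrace_mulC -mulmxA spectral_decomp_mulmx_tr.
by rewrite mulmx1 mxtrace_diag; apply: eq_bigr => i _; rewrite mxE.
Qed.

Lemma dot_expr_spectral k v :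
  dot v (A ^+ k *m v) = \sum_i (P *m v) i 0 ^+ 2 * l 0 i ^+ k.
Proof.
rewrite spectral_decomp_expr -!mulmxA dot_mulmx_tr trmxK; apply: eq_bigr => i _.
by rewrite mul_diag_mx [X in _ * X = _]mxE [(\row_i _) 0 i]mxE mulrCA -expr2 mulrC.
Qed.

Lemma sum_sqr_coord (I : finType) (Q : pred I) (a : I -> 'cV[R]_n) i :
  \sum_(j | Q j) (P *m a j) i 0 ^+ 2 = (P *m (\sum_(j | Q j) outer (a j)) *m P^T) i i.
Proof.
rewrite mulmx_sumr mulmx_suml summxE; apply: eq_bigr => j _.
by rewrite /outer mulmxA -mulmxA -trmx_mul [RHS]mxE big_ord1 expr2 [X in _ = _ * X]mxE.
Qed.

Lemma dot_spectral v : dot v (A *m v) = \sum_i (P *m v) i 0 ^+ 2 * l 0 i.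
Proof. exact: (dot_expr_spectral 1). Qed.

Lemma sum_sqr_spectral v : \sum_i (P *m v) i 0 ^+ 2 = dot v v.
Proof.
have := dot_expr_spectral 0 v; rewrite expr0 mul1mx => ->.
by apply: eq_bigr => i _; rewrite expr0 mulr1.
Qed.

Lemma psd_spectral : (forall i, 0 <= l 0 i) -> psd A.
Proof.
move=> l_ge0; split; first by rewrite decA.2 !trmx_mul trmxK tr_diag_mx mulmxA.
by move=> v; rewrite dot_spectral sumr_ge0 // => i _; rewrite mulr_ge0 ?sqr_ge0.
Qed.

Lemma psd_spectral_ge0 i : psd A -> 0 <= l 0 i.
Proof.
move=> psdA; have := psdA.2 (P^T *m delta_mx i 0).
rewrite dot_spectral mulmxA spectral_decomp_mulmx_tr mul1mx (bigD1 i) //= big1 => [|j ji].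
  by rewrite mxE !eqxx expr1n mul1r addr0.
by rewrite mxE (negbTE ji) expr0n mul0r.
Qed.

End SpectralDecomp.

Section Householder.
Variables (R : realFieldType) (n : nat).
Implicit Types u v w : 'cV[R]_n.

Definition householder w : 'M[R]_n := 1%:M - (2 / dot w w) *: outer w.

Lemma tr_householder w : (householder w)^T = householder w.
Proof. by rewrite linearB linearZ /= trmx1 tr_outer. Qed.

Lemma householderK w : householder w *m householder w = 1%:M.
Proof.
have [->|w_neq0] := eqVneq w 0.
  by rewrite /householder /outer mul0mx scaler0 subr0 mulmx1.
have outer_sqr : outer w *m outer w = dot w w *: outer w.
  by rewrite [X in _ *m X]/outer mulmxA mul_outer -scalemxAl.
rewrite mulmxBl mul1mx -scalemxAl mulmxBr mulmx1 -scalemxAr outer_sqr.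
have coefE : 2 / dot w w * (2 / dot w w) * dot w w = 2 / dot w w + 2 / dot w w.
  by field; rewrite dot_eq0.
by rewrite scalerBr !scalerA coefE scalerDl opprB addrK subrK.
Qed.

Lemma householder_swap u v : dot u u = dot v v -> householder (u - v) *m u = v.
Proof.
move=> uv; have [/eqP|uv_neq0] := eqVneq (u - v) 0.
  rewrite subr_eq0 => /eqP ->.
  by rewrite /householder subrr /outer mul0mx scaler0 subr0 mul1mx.
have dot_diff : dot (u - v) u = dot (u - v) (u - v) / 2.
  by rewrite !(dotBl, dotBr) (dotC v u) -uv; field.
rewrite mulmxBl mul1mx -scalemxAl mul_outer scalerA dot_diff.
have /lt0r_neq0 diff_neq0 : 0 < dot (u - v) (u - v) by rewrite dot_gt0.
rewrite (_ : _ * _ = 1); last by field.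
by rewrite scale1r opprB addrC subrK.
Qed.

End Householder.

Section SpectralTheorem.
Variable R : rcfType.

Lemma symmetric_eigenvalue n (A : 'M[R]_n.+1) : A^T = A -> exists a, eigenvalue A a.
Proof.
move=> symA; pose Ac : 'M[R[i]]_n.+1 := map_mx (real_complex R) A.
have hermA : Ac \is hermsymmx.
  apply: realsym_hermsym.
    by apply/is_hermitianmxP; rewrite expr0 scale1r map_mx_id // map_trmx symA.
  by apply/mxOverP => i j; rewrite mxE complex_real.
have /mxOverP/(_ 0 0)/RRe_real eigR := hermitian_spectral_diag_real hermA.
have /hermitian_normalmx/orthomx_spectralP A_eq := hermA.
exists (complex.Re (spectral_diag Ac 0 0)).
rewrite eigenvalue_root_char -(fmorph_root (real_complex R)) map_char_poly.
rewrite -eigenvalue_root_char /= eigR; apply/eigenvalueP.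
exists (row 0 (spectralmx Ac)).
  rewrite -row_mul [X in row 0 (_ *m X)]A_eq !mulmxA mulmxV ?spectral_unit // mul1mx.
  by rewrite row_mul row_diag_mx -scalemxAl -rowE.
apply/eqP; rewrite rowE => /(congr1 (mulmx^~ (invmx (spectralmx Ac)))).
rewrite mulmxK ?spectral_unit // mul0mx => /rowP/(_ 0).
by rewrite !mxE => /eqP; rewrite oner_eq0.
Qed.

Lemma symmetric_unit_eigenvector n (A : 'M[R]_n.+1) :
  A^T = A -> exists a u, dot u u = 1 /\ A *m u = a *: u.
Proof.
move=> symA; have [a /eigenvalueP[v vA v_neq0]] := symmetric_eigenvalue symA.
have v_gt0 : 0 < dot v^T v^T by rewrite dot_gt0 trmx_eq0.
exists a, ((Num.sqrt (dot v^T v^T))^-1 *: v^T); split.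
  rewrite dotZl dotZr mulrA -expr2 exprVn sqr_sqrtr ?ltW //.
  by rewrite mulVf // gt_eqF.
by rewrite -scalemxAr -[in LHS]symA -trmx_mul vA linearZ /= !scalerA mulrC.
Qed.

Lemma symmetric_deflation n (A : 'M[R]_(1 + n)) : A^T = A ->
  exists H a (B : 'M[R]_n),
    [/\ H^T = H, H *m H = 1%:M, B^T = B & A = H *m block_mx a%:M 0 0 B *m H].
Proof.
move=> symA; have [a [u [u_unit Au]]] := symmetric_unit_eigenvector symA.
pose e0 : 'cV[R]_(1 + n) := col_mx 1%:M 0.
have e0_unit : dot e0 e0 = 1.
  rewrite /dot big_split_ord big_ord1 /= col_mxEu !mxE mulr1 big1 ?addr0 // => i _.
  by rewrite col_mxEd mxE mulr0.
pose H := householder (e0 - u).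
have He0 : H *m e0 = u by apply: householder_swap; rewrite e0_unit u_unit.
have HK : H *m H = 1%:M := householderK _.
have symH : H^T = H := tr_householder _.
pose D := H *m A *m H.
have symD : D^T = D by rewrite /D !trmx_mul symA symH mulmxA.
have De0 : D *m e0 = a *: e0.
  by rewrite /D -!mulmxA He0 Au -scalemxAr -He0 mulmxA HK mul1mx.
have [D_ul D_dl] : ulsubmx D = a%:M /\ dlsubmx D = 0.
  apply: eq_col_mx; move: De0; rewrite -{1}[D]submxK mul_block_col !mulmx1 !mulmx0.
  by rewrite !addr0 scale_col_mx scaler0 scale_scalar_mx mulr1.
have D_ur : ursubmx D = 0 by rewrite -symD -trmx_dlsub D_dl trmx0.
exists H, a, (drsubmx D); split=> //; first by rewrite trmx_drsub symD.
rewrite -D_ul -[X in block_mx _ X]D_ur -D_dl submxK.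
by rewrite /D -!mulmxA HK mulmx1 mulmxA HK mul1mx.
Qed.

Lemma spectral_theorem n (A : 'M[R]_n) : A^T = A -> exists P l, spectral_decomp A P l.
Proof.
elim: n A => [|n IH] A symA.
  by exists 1%:M, 0; split; apply/matrixP => -[].
move: A symA; rewrite -[n.+1]/(1 + n)%N => A symA.
have [H [a [B [symH HK /IH[Q [l [QQ ->]]] ->]]]] := symmetric_deflation symA.
exists (block_mx 1%:M 0 0 Q *m H), (row_mx a%:M l); split.
  rewrite trmx_mul symH tr_block_mx trmx1 !trmx0 mulmxA -(mulmxA H) mulmx_block.
  by rewrite !(mulmx0, mul0mx, mulmx1, addr0, add0r) QQ -scalar_mx_block mulmx1.
rewrite trmx_mul symH tr_block_mx trmx1 !trmx0 diag_mx_row -!(mulmxA H); congr (_ *m _).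
rewrite mulmxA; congr (_ *m _).
rewrite !mulmx_block !(mulmx0, mul0mx, mulmx1, mul1mx, addr0, add0r).
by congr block_mx; apply/matrixP => i j; rewrite !ord1 !mxE.
Qed.

End SpectralTheorem.

(** * The trace exponential *)

Section ExpR.
Variable R : realType.

Lemma cvg_series_exp_coeff (x : R) : (series (exp_coeff x) @ \oo --> expR x)%classic.
Proof. exact: is_cvg_series_exp_coeff. Qed.

Lemma cvg_series_sum_expR (I : finType) (c x : I -> R) :
  (series (fun k => (\sum_i c i * x i ^+ k) / k`!%:R) @ \oo
    --> \sum_i c i * expR (x i))%classic.
Proof.
have -> : series (fun k => (\sum_i c i * x i ^+ k) / k`!%:R)
    = (fun N => \sum_i c i * series (exp_coeff (x i)) N).
  apply/funext => N; rewrite /series /=.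
  under [RHS]eq_bigr do rewrite mulr_sumr.
  rewrite exchange_big /=; apply: eq_bigr => k _; rewrite mulr_suml.
  by apply: eq_bigr => i _; rewrite /exp_coeff /= mulrA.
apply: cvg_big => [|i _]; first exact: add_continuous.
by apply: cvgMl_tmp; exact: cvg_series_exp_coeff.
Qed.

Lemma expR_subr1_le (a x : R) : 0 <= a <= 1 -> expR (a * x) - 1 <= a * (expR x - 1).
Proof.
move=> a01; have [a_ge0 a_le1] := andP a01.
have := convex_expR (Itv01 a_ge0 a_le1) x 0.
rewrite !convRE /= expR0 mulr0 addr0 /unstable.onem; lra.
Qed.

Lemma expR_le_quadratic (x : R) : `|x| <= 1 / 4 -> expR x <= 1 + x + x ^+ 2.
Proof.
rewrite ler_norml => /andP[x_ge x_le].
have half_gt0 : 0 < 1 - x / 2 by lra.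
have expV : expR x * expR (- (x / 2)) ^+ 2 = 1.
  by rewrite expr2 -!expRD -[RHS]expR0; congr expR; field.
have sqr_le : (1 - x / 2) ^+ 2 <= expR (- (x / 2)) ^+ 2.
  by rewrite ler_sqr ?nnegrE ?expR_ge0 ?(ltW half_gt0) ?expR_ge1Dx.
rewrite -(ler_pM2r (exprn_gt0 2 half_gt0)); apply: (@le_trans _ _ 1).
  by rewrite -[leRHS]expV ler_pM2l ?expR_gt0.
have -> : (1 + x + x ^+ 2) * (1 - x / 2) ^+ 2
    = 1 + x ^+ 2 / 4 * (1 - 3 * x + x ^+ 2) by field.
by rewrite lerDl mulr_ge0 ?divr_ge0 ?sqr_ge0 //; nra.
Qed.

Lemma exp2_fact_le_fact_double k : (2 ^ k * k`! <= k.*2`!)%N.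
Proof.
elim: k => // k IH; rewrite doubleS !factS expnS.
apply: leq_trans (_ : k.*2.+2 * (2 ^ k * k`!) <= _)%N.
  by rewrite -doubleS -mul2n !mulnA [(2 * _ * _)%N]mulnAC.
by rewrite leq_mul2l /=; apply: leq_trans IH _; rewrite leq_pmull.
Qed.

Definition exp_coeff_even_part (c : R) k : R := exp_coeff c k + exp_coeff (- c) k.

Lemma exp_coeff_even_part_double c k :
  exp_coeff_even_part c k.*2 = 2 * (c ^+ k.*2 / k.*2`!%:R).
Proof.
rewrite /exp_coeff_even_part /exp_coeff /= exprNn -signr_odd odd_double expr0 mul1r.
by rewrite mulr_natl mulr2n.
Qed.

Lemma exp_coeff_even_part_doubleS c k : exp_coeff_even_part c k.*2.+1 = 0.
Proof.
rewrite /exp_coeff_even_part /exp_coeff /= exprNn -signr_odd /= odd_double expr1.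
by rewrite mulN1r mulNr subrr.
Qed.

Lemma exp_coeff_even_part_ge0 c k : 0 <= exp_coeff_even_part c k.
Proof.
rewrite -(odd_double_half k); case: (odd k) => /=.
  by rewrite add1n exp_coeff_even_part_doubleS.
rewrite add0n exp_coeff_even_part_double mulr_ge0 // divr_ge0 //.
by rewrite exprn_even_ge0 // odd_double.
Qed.

Lemma series_exp_coeff_even_part_le c N :
  series (exp_coeff_even_part c) N <= 2 * series (exp_coeff (c ^+ 2 / 2)) N.
Proof.
apply: (@le_trans _ _ (series (exp_coeff_even_part c) N.*2)).
  rewrite /series /= (@big_cat_nat _ _ _ N 0%N N.*2) -?addnn ?leq_addr //=.
  by rewrite lerDl sumr_ge0 // => k _; exact: exp_coeff_even_part_ge0.
elim: N => [|k IH]; first by rewrite /series /= !big_nil mulr0.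
rewrite doubleS !seriesS exp_coeff_even_part_doubleS add0r mulrDr lerD //.
rewrite exp_coeff_even_part_double ler_wpM2l // /exp_coeff /= expr_div_n -exprM mul2n.
rewrite -mulrA ler_wpM2l //; first by rewrite exprn_even_ge0 // odd_double.
rewrite -invfM -natrX -natrM lef_pV2 ?posrE ?ltr0n ?muln_gt0 ?fact_gt0 ?expn_gt0 //.
by rewrite ler_nat exp2_fact_le_fact_double.
Qed.

Lemma expR_add_expRN_le (c : R) : expR c + expR (- c) <= 2 * expR (c ^+ 2 / 2).
Proof.
have cvg_sqr : ((fun N => 2 * series (exp_coeff (c ^+ 2 / 2)) N) @ \oo -->
    2 * expR (c ^+ 2 / 2))%classic.
  by apply: cvgMl_tmp; exact: cvg_series_exp_coeff.
apply: (ler_cvg_to (cvgD (@cvg_series_exp_coeff c) (@cvg_series_exp_coeff (- c))) cvg_sqr).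
apply: nearW => N.
rewrite fctE /series /= -big_split /=; exact: series_exp_coeff_even_part_le.
Qed.

End ExpR.

Section ChernoffRate.
Variables (R : realType) (beta : R).
Hypothesis beta_gt0 : 0 < beta.

Definition chernoff_rate (th : R) : R := (expR (th * beta) - 1) / beta.

Lemma chernoff_rate_ge th : th <= chernoff_rate th.
Proof. by rewrite ler_pdivlMr // lerBrDl expR_ge1Dx. Qed.

Lemma chernoff_rate_convex a th :
  0 <= a <= 1 -> chernoff_rate (a * th) <= a * chernoff_rate th.
Proof.
by move=> a01; rewrite mulrA ler_pM2r ?invr_gt0 // -mulrA expR_subr1_le.
Qed.

Lemma chernoff_rate_le th : `|th * beta| <= 1 / 4 ->
  chernoff_rate th <= th + th ^+ 2 * beta.
Proof.
move=> /expR_le_quadratic expR_le; rewrite ler_pdivrMr //; lra.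
Qed.

End ChernoffRate.

Section TraceExp.
Variable R : realType.
Implicit Types n : nat.

Definition trace_exp n (A : 'M[R]_n) : R := limn (series (fun k => \tr (A ^+ k) / k`!%:R)).

Lemma cvg_trace_exp_spectral n (A P : 'M[R]_n) l : spectral_decomp A P l ->
  (series (fun k => \tr (A ^+ k) / k`!%:R) @ \oo --> \sum_i expR (l 0 i))%classic.
Proof.
move=> decA; have -> : (fun k => \tr (A ^+ k) / k`!%:R)
    = (fun k => (\sum_i 1 * l 0 i ^+ k) / k`!%:R).
  apply/funext => k; rewrite (mxtrace_expr_spectral decA); congr (_ / _).
  by apply: eq_bigr => i _; rewrite mul1r.
have -> : \sum_i expR (l 0 i) = \sum_i 1 * expR (l 0 i).
  by apply: eq_bigr => i _; rewrite mul1r.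
exact: cvg_series_sum_expR.
Qed.

Lemma trace_exp_spectral n (A P : 'M[R]_n) l : spectral_decomp A P l ->
  trace_exp A = \sum_i expR (l 0 i).
Proof. by move=> /cvg_trace_exp_spectral/cvg_lim; apply. Qed.

Lemma trace_expZ n (A P : 'M[R]_n) l c : spectral_decomp A P l ->
  trace_exp (c *: A) = \sum_i expR (c * l 0 i).
Proof.
move=> decA; rewrite (trace_exp_spectral (spectral_decompZ decA c)).
by apply: eq_bigr => i _; rewrite mxE.
Qed.

Lemma trace_expD_scalar n (A : 'M[R]_n) c : A^T = A ->
  trace_exp (A + c%:M) = trace_exp A * expR c.
Proof.
move=> symA; have [P [l decA]] := spectral_theorem symA.
have := spectral_decomp_affine decA 1 c; rewrite scale1r => /trace_exp_spectral ->.
rewrite (trace_exp_spectral decA) mulr_suml.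
by apply: eq_bigr => i _; rewrite mxE mul1r expRD.
Qed.

Lemma trace_exp_ge0 n (A : 'M[R]_n) : A^T = A -> 0 <= trace_exp A.
Proof.
move=> symA; have [P [l decA]] := spectral_theorem symA.
by rewrite (trace_exp_spectral decA) sumr_ge0 // => i _; exact: expR_ge0.
Qed.

Lemma trace_exp0 n : trace_exp (0 : 'M[R]_n) = n%:R.
Proof.
have dec0 : spectral_decomp (0 : 'M[R]_n) 1%:M 0.
  by split; rewrite ?trmx1 ?mul1mx // mulmx1 raddf0.
rewrite (trace_exp_spectral dec0) (eq_bigr (fun=> 1)) => [|i _].
  by rewrite sumr_const card_ord.
by rewrite mxE expR0.
Qed.

Lemma dot_le_trace_exp n (A : 'M[R]_n) (th s : R) x : A^T = A -> 0 < th ->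
  trace_exp (th *: A) <= expR (th * s) -> dot x (A *m x) <= s * dot x x.
Proof.
move=> symA th_gt0; have [P [l decA]] := spectral_theorem symA.
rewrite (trace_expZ th decA) (dot_spectral decA) -(sum_sqr_spectral decA) mulr_sumr.
move=> trace_le; apply: ler_sum => i _; rewrite mulrC ler_wpM2r ?sqr_ge0 //.
rewrite -(ler_pM2l th_gt0) -ler_expR; apply: le_trans trace_le.
by rewrite (bigD1 i) //= lerDl; apply: sumr_ge0 => j _; apply: expR_ge0.
Qed.

Variable n : nat.
Implicit Types (A P : 'M[R]_n) (v : 'cV[R]_n).

Lemma trace_expD_outer_psd A v (th beta : R) P l :
  dot v v <= beta -> 0 < beta -> psd A -> psd (A + (th * beta)%:M) ->
  spectral_decomp A P l ->
  trace_exp (A + th *: outer v)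
    <= \sum_i expR (l 0 i) * (1 + chernoff_rate beta th * (P *m v) i 0 ^+ 2).
Proof.
move=> v_le beta_gt0 psdA psdC decA.
have symB : (A + th *: outer v)^T = A + th *: outer v.
  by rewrite linearD linearZ /= psdA.1 tr_outer.
have [P' [l' decB]] := spectral_theorem symB.
have := spectral_decomp_affine decA 1 (th * beta); rewrite scale1r => decC.
pose w i := beta^-1 * (P *m v) i 0 ^+ 2.
have -> : \sum_i expR (l 0 i) * (1 + chernoff_rate beta th * (P *m v) i 0 ^+ 2)
    = \sum_i (1 - w i) * expR (l 0 i) + \sum_i w i * expR (l 0 i + th * beta).
  by rewrite -big_split; apply: eq_bigr => i _; rewrite /= expRD /chernoff_rate /w; ring.
have cvg_now := @cvg_series_sum_expR _ _ (fun i => 1 - w i) (l 0).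
have cvg_next := @cvg_series_sum_expR _ _ w (fun i => l 0 i + th * beta).
rewrite (trace_exp_spectral decB).
apply: (ler_cvg_to (cvg_trace_exp_spectral decB) (cvgD cvg_now cvg_next)).
apply: nearW => N; rewrite fctE /series /= -big_split.
apply: ler_sum => k _ /=; rewrite -mulrDl ler_wpM2r ?invr_ge0 //.
apply: le_trans (trace_exprD_outer_le k v_le beta_gt0 psdA psdC) _.
rewrite (mxtrace_expr_spectral decA) (dot_expr_spectral decA) (dot_expr_spectral decC).
rewrite -sumrB mulr_sumr -!big_split /=.
by apply: ler_sum => i _; rewrite mxE /w mul1r; lra.
Qed.

(* Adding a multiple of the identity to [A] makes both psd hypotheses hold and
   multiplies the two sides by the same factor. *)
Lemma trace_expD_outer A v (th beta : R) P l :
  A^T = A -> dot v v <= beta -> 0 < beta -> spectral_decomp A P l ->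
  trace_exp (A + th *: outer v)
    <= \sum_i expR (l 0 i) * (1 + chernoff_rate beta th * (P *m v) i 0 ^+ 2).
Proof.
move=> symA v_le beta_gt0 decA.
pose c := \sum_i `|l 0 i| + `|th * beta|.
have l_le i : `|l 0 i| <= \sum_i `|l 0 i|.
  by rewrite (bigD1 i) //= lerDl; apply: sumr_ge0.
have dec_shift e := spectral_decomp_affine decA 1 e; rewrite scale1r in dec_shift.
have psd_shift : psd (A + c%:M).
  apply: psd_spectral (dec_shift c) _ => i; rewrite mxE /c.
  have := l_le i; have := ler_norm (- l 0 i); rewrite normrN.
  by have := normr_ge0 (th * beta); lra.
have psd_shift2 : psd (A + c%:M + (th * beta)%:M).
  rewrite -addrA -raddfD /=; apply: psd_spectral (dec_shift _) _ => i; rewrite mxE /c.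
  have := l_le i; have := ler_norm (- l 0 i); rewrite normrN.
  by have := ler_norm (- (th * beta)); rewrite normrN; lra.
rewrite -(ler_pM2r (expR_gt0 c)) -trace_expD_scalar; last first.
  by rewrite linearD linearZ /= symA tr_outer.
rewrite addrAC; apply: le_trans
  (trace_expD_outer_psd v_le beta_gt0 psd_shift psd_shift2 (dec_shift c)) _.
by rewrite mulr_suml; apply: ler_sum => i _; rewrite mxE mul1r expRD mulrAC.
Qed.

End TraceExp.

(** * Sampling without replacement *)

Section Sampling.
Variables (R : realType) (T : finType) (d r : nat) (v : T -> 'cV[R]_d).
Local Notation sample := {ffun 'I_r -> T}.
Implicit Types (s : sample) (k : nat).

Definition draws : {set sample} := [set s : sample | injectiveb s].

Definition drawn k s : {set T} := [set s i | i : 'I_r & (i < k)%N].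

Definition partial_gram k s : 'M[R]_d := \sum_(i < r | (i < k)%N) outer (v (s i)).

Definition sample_gram s : 'M[R]_d := \sum_i outer (v (s i)).

Lemma card_drawn k s : s \in draws -> (k <= r)%N -> #|drawn k s| = k.
Proof.
rewrite inE => /injectiveP inj_s k_le; rewrite card_imset //.
rewrite -sum1_card (eq_bigl (fun i : 'I_r => (i < k)%N)) => [|i]; last by rewrite inE.
by rewrite -(big_ord_widen r (fun=> 1%N)) // sum1_card card_ord.
Qed.

Lemma card_undrawn k s : s \in draws -> (k <= r)%N -> #|~: drawn k s| = (#|T| - k)%N.
Proof. by move=> s_inj k_le; rewrite cardsCs finset.setCK card_drawn. Qed.

Lemma sum_undrawn k s : s \in draws ->
  \sum_(j in ~: drawn k s) outer (v j) = \sum_j outer (v j) - partial_gram k s.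
Proof.
rewrite inE => /injectiveP inj_s.
have -> : partial_gram k s = \sum_(j in drawn k s) outer (v j).
  rewrite big_imset /=; last by move=> ? ? _ _; exact: inj_s.
  by apply: eq_bigl => i; rewrite inE.
rewrite [X in _ = X - _](bigID (mem (drawn k s))) /= [RHS]addrC addKr.
by apply: eq_bigl => i; rewrite inE.
Qed.

(* The involution showing that, given the first draws, the value drawn at time
   [k] is uniform among those still available. *)
Definition redraw (k : 'I_r) (x : sample * T) : sample * T :=
  ([ffun i => tperm (x.1 k) x.2 (x.1 i)], x.1 k).

Lemma redrawK (k : 'I_r) : involutive (redraw k).
Proof.
move=> [s j]; rewrite /redraw /= ffunE tpermL; congr (_, _).
by apply/ffunP => i; rewrite !ffunE tpermC tpermK.
Qed.

Lemma redraw_before (k : 'I_r) s j (i : 'I_r) :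
  s \in draws -> j \notin drawn k s -> (i < k)%N -> (redraw k (s, j)).1 i = s i.
Proof.
rewrite inE => /injectiveP inj_s j_new i_lt; rewrite /redraw /= ffunE tpermD //.
  by apply/eqP => /inj_s ki; rewrite ki ltnn in i_lt.
by apply: contraNneq j_new => ->; apply: imset_f; rewrite inE.
Qed.

Lemma drawn_redraw (k : 'I_r) s j : s \in draws -> j \notin drawn k s ->
  drawn k (redraw k (s, j)).1 = drawn k s.
Proof.
move=> s_inj j_new; apply/setP => z.
by apply/imsetP/imsetP => -[i0]; rewrite inE => i0_lt ->;
  exists i0; rewrite ?inE // redraw_before.
Qed.

Lemma redraw_draws (k : 'I_r) x :
  ((redraw k x).1 \in draws) && ((redraw k x).2 \notin drawn k (redraw k x).1)
    = (x.1 \in draws) && (x.2 \notin drawn k x.1).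
Proof.
have redraw_closed (y : sample * T) : (y.1 \in draws) && (y.2 \notin drawn k y.1) ->
    ((redraw k y).1 \in draws) && ((redraw k y).2 \notin drawn k (redraw k y).1).
  case: y => s j /= /andP[s_inj j_new]; rewrite drawn_redraw //.
  move: s_inj; rewrite !inE => /injectiveP inj_s.
  apply/andP; split; first by apply/injectiveP => i i'; rewrite !ffunE => /perm_inj/inj_s.
  by apply/imsetP => -[i0]; rewrite inE => i0_lt /inj_s ki0; rewrite ki0 ltnn in i0_lt.
by apply/idP/idP => [/redraw_closed|/redraw_closed //]; rewrite redrawK.
Qed.

Lemma sum_next_draw (k : 'I_r) (G : sample -> R) :
  (#|T| - k)%:R * \sum_(s in draws) G s
    = \sum_(s in draws) \sum_(j in ~: drawn k s) G (redraw k (s, j)).1.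
Proof.
transitivity (\sum_(s in draws) \sum_(j in ~: drawn k s) G s).
  rewrite mulr_sumr; apply: eq_bigr => s s_inj.
  by rewrite sumr_const card_undrawn ?mulr_natl // ltnW.
rewrite !pair_big_dep /= (reindex_inj (inv_inj (@redrawK k))) /=.
by apply: eq_bigl => x; have := redraw_draws k x; rewrite !inE.
Qed.

Lemma partial_gram_redraw (k : 'I_r) s j : s \in draws -> j \notin drawn k s ->
  partial_gram k.+1 (redraw k (s, j)).1 = partial_gram k s + outer (v j).
Proof.
move=> s_inj j_new; rewrite /partial_gram sum_ord_ltS; congr (_ + outer (v _)).
  by apply: eq_bigr => i i_lt; rewrite redraw_before.
by rewrite ffunE tpermL.
Qed.

Variables beta tau : R.
Hypotheses (beta_gt0 : 0 < beta) (v_le : forall j, dot (v j) (v j) <= beta).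
Hypotheses (tau_ge0 : 0 <= tau) (sum_v : \sum_j outer (v j) = tau%:M).
Local Notation rate := (chernoff_rate beta).

Lemma draw_factor_le (th l N : R) : 0 <= l -> 0 < N ->
  expR (th * l) * (N + rate th * (tau - l))
    <= N * (expR (th * (1 - N^-1) * l) * expR (rate th * (tau / N))).
Proof.
move=> l_ge0 N_gt0; rewrite -expRD.
have -> : N + rate th * (tau - l) = N * (1 + rate th * (tau - l) / N).
  by field; rewrite gt_eqF.
rewrite mulrCA ler_pM2l //.
apply: (@le_trans _ _ (expR (th * l) * expR (rate th * (tau - l) / N))).
  by rewrite ler_pM2l ?expR_gt0 // expR_ge1Dx.
rewrite -expRD ler_expR.
have : th * (l / N) <= rate th * (l / N).
  by rewrite ler_wpM2r ?chernoff_rate_ge // divr_ge0 // ltW.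
lra.
Qed.

Lemma sum_trace_exp_draw (J : {set T}) (S : 'M[R]_d) (th : R) :
  (0 < #|J|)%N -> psd S -> \sum_(j in J) outer (v j) = tau%:M - S ->
  \sum_(j in J) trace_exp (th *: (S + outer (v j)))
    <= #|J|%:R * (trace_exp ((th * (1 - #|J|%:R^-1)) *: S)
        * expR (rate th * (tau / #|J|%:R))).
Proof.
move=> J_gt0 psdS sum_J; have [P [l decS]] := spectral_theorem psdS.1.
have sym_thS : (th *: S)^T = th *: S by rewrite linearZ /= psdS.1.
have draw_le j : trace_exp (th *: (S + outer (v j)))
    <= \sum_i expR (th * l 0 i) * (1 + rate th * (P *m v j) i 0 ^+ 2).
  have dec_thS := spectral_decompZ decS th; rewrite scalerDr.
  apply: le_trans (trace_expD_outer th sym_thS (v_le j) beta_gt0 dec_thS) _.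
  by apply: ler_sum => i _; rewrite mxE.
apply: le_trans (ler_sum _ (fun j _ => draw_le j)) _.
rewrite exchange_big /= (trace_expZ _ decS) mulr_suml mulr_sumr.
apply: ler_sum => i _; rewrite -mulr_sumr big_split /= sumr_const -mulr_sumr.
have -> : \sum_(j in J) (P *m v j) i 0 ^+ 2 = tau - l 0 i.
  rewrite sum_sqr_coord sum_J mulmxBr mulmxBl (spectral_decomp_diag decS).
  rewrite mul_mx_scalar -scalemxAl (spectral_decomp_mulmx_tr decS) !mxE eqxx.
  by rewrite mulr1.
by apply: draw_factor_le; rewrite ?ltr0n // (psd_spectral_ge0 decS).
Qed.

Hypothesis r_le : (r <= #|T|)%N.

Lemma sample_exponent_le (th : R) k : (k < #|T|)%N ->
  rate (th * (1 - (#|T| - k)%:R^-1)) * (tau * (k%:R / #|T|%:R))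
      + rate th * (tau / (#|T| - k)%:R)
    <= rate th * (tau * (k.+1%:R / #|T|%:R)).
Proof.
move=> k_lt; set N : R := (#|T| - k)%:R.
have N_ge1 : 1 <= N by rewrite ler1n subn_gt0.
have card_T : #|T|%:R = N + k%:R :> R by rewrite -natrD subnK // ltnW.
have k_ge0 : 0 <= k%:R :> R by [].
have shrink01 : 0 <= 1 - N^-1 <= 1.
  have NV_ge0 : 0 <= N^-1 by rewrite invr_ge0; lra.
  have : N^-1 <= 1 by rewrite invf_le1; lra.
  lra.
have mean_ge0 : 0 <= tau * (k%:R / #|T|%:R) by rewrite mulr_ge0 // divr_ge0.
have := ler_wpM2r mean_ge0 (chernoff_rate_convex beta_gt0 th shrink01).
rewrite [_ * th]mulrC -(lerD2r (rate th * (tau / N))) => /le_trans; apply.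
rewrite (_ : _ + _ = rate th * (tau * (k.+1%:R / #|T|%:R))) // card_T -natr1.
by field; apply/andP; split; lra.
Qed.

(* The exponent is that of independent draws: passing from [k] to [k + 1] draws
   shrinks the parameter by the factor [1 - 1/N], which compensates the larger
   mean [tau / N] of the draw among the [N] remaining vectors. *)
Lemma sum_trace_exp_partial_gram th k : (k <= r)%N ->
  \sum_(s in draws) trace_exp (th *: partial_gram k s)
    <= #|draws|%:R * (d%:R * expR (rate th * (tau * (k%:R / #|T|%:R)))).
Proof.
elim: k th => [|k IH] th k_le.
  rewrite mul0r !mulr0 expR0 mulr1 (eq_bigr (fun=> d%:R)) => [|s _].
    by rewrite sumr_const mulr_natl.
  by rewrite /partial_gram big_pred0 // scaler0 trace_exp0.
pose K := Ordinal k_le; set N : R := (#|T| - k)%:R.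
have k_lt : (k < #|T|)%N := leq_trans k_le r_le.
have N_gt0 : 0 < N by rewrite ltr0n subn_gt0.
have draw_le : \sum_(s in draws) trace_exp (th *: partial_gram k.+1 s)
    <= (\sum_(s in draws) trace_exp ((th * (1 - N^-1)) *: partial_gram k s))
       * expR (rate th * (tau / N)).
  rewrite -(ler_pM2l N_gt0) (sum_next_draw K) mulr_suml mulr_sumr.
  apply: ler_sum => s s_inj; have card_J := card_undrawn s_inj (ltnW k_le).
  rewrite /N -card_J; apply: le_trans (sum_trace_exp_draw th _ (psd_sum_outer _ _) _).
  - by apply: ler_sum => j; rewrite inE => j_new; rewrite (partial_gram_redraw (k := K)).
  - by rewrite card_J subn_gt0.
  - by rewrite sum_undrawn // sum_v.
apply: le_trans draw_le _; rewrite mulrC.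
apply: le_trans (ler_wpM2l (expR_ge0 _) (IH _ (ltnW k_le))) _.
rewrite mulrC -mulrA ler_wpM2l // -mulrA ler_wpM2l // -expRD ler_expR.
exact: sample_exponent_le.
Qed.

End Sampling.

Section NearIdentity.
Variables (R : realFieldType) (d : nat).

Definition near_identity (eta : R) (S : 'M[R]_d) : Prop :=
  forall x, `|dot x (S *m x) - dot x x| <= eta * dot x x.

Lemma near_identity_dot (eta : R) (S : 'M[R]_d) x y : S^T = S ->
  near_identity eta S ->
  dot x (S *m y) - dot x y <= eta / 2 * (dot x x + dot y y).
Proof.
move=> symS nearS.
have := nearS (x - y); have := nearS (x + y).
rewrite !ler_norml => /andP[_ sum_le] /andP[diff_ge _].
rewrite !dot_symD // mulmxN !(dotDl, dotDr, dotNl, dotNr) (dotC y x) opprK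
  in sum_le diff_ge.
have -> : dot x (S *m y) = dot y (S *m x) by rewrite dot_mulmx_tr symS dotC.
by lra.
Qed.

End NearIdentity.

Section Chernoff.
Variables (R : realType) (d : nat).

Lemma near_identity_trace_exp (S : 'M[R]_d) (th eta : R) : S^T = S -> 0 < th ->
  trace_exp (th *: S) <= expR (th * (1 + eta)) ->
  trace_exp (- th *: S) <= expR (- th * (1 - eta)) ->
  near_identity eta S.
Proof.
move=> symS th_gt0 upper lower x.
have S_le := dot_le_trace_exp x symS th_gt0 upper.
have symN : (- S)^T = - S by rewrite linearN /= symS.
have SN_le : dot x (- S *m x) <= - (1 - eta) * dot x x.
  by apply: (dot_le_trace_exp x symN th_gt0); rewrite scalerN -scaleNr mulrN -mulNr.
by rewrite mulNmx dotNr in SN_le; rewrite ler_norml; lra.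
Qed.

Variables (T : finType) (r : nat) (v : T -> 'cV[R]_d) (beta tau : R).
Hypotheses (beta_gt0 : 0 < beta) (v_le : forall j, dot (v j) (v j) <= beta).
Hypotheses (tau_ge0 : 0 <= tau) (sum_v : \sum_j outer (v j) = tau%:M).
Hypotheses (r_le : (r <= #|T|)%N) (mean_eq1 : tau * (r%:R / #|T|%:R) = 1).

Lemma psd_sample_gram (s : {ffun 'I_r -> T}) : psd (sample_gram v s).
Proof. exact: psd_sum_outer. Qed.

Lemma sum_trace_exp_sample_gram th :
  \sum_(s in draws T r) trace_exp (th *: sample_gram v s)
    <= #|draws T r|%:R * (d%:R * expR (chernoff_rate beta th)).
Proof.
have partial_gram_all (s : {ffun 'I_r -> T}) : partial_gram v r s = sample_gram v s.
  by apply: eq_bigl => i; rewrite ltn_ord.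
have := sum_trace_exp_partial_gram beta_gt0 v_le tau_ge0 sum_v r_le th (leqnn r).
by under eq_bigr do rewrite partial_gram_all; rewrite mean_eq1 mulr1.
Qed.

Lemma card_trace_exp_tail (th eta : R) : `|th * beta| = eta / 2 -> eta <= 1 / 2 ->
  #|[set s in draws T r |
      expR (th + eta ^+ 2 / (2 * beta)) < trace_exp (th *: sample_gram v s)]|%:R
    <= #|draws T r|%:R * (d%:R * expR (- (eta ^+ 2 / (4 * beta)))).
Proof.
move=> th_eta eta_le; set a := th + _.
have trace_ge0 (s : {ffun 'I_r -> T}) : 0 <= trace_exp (th *: sample_gram v s).
  by apply: trace_exp_ge0; rewrite linearZ /= (psd_sample_gram s).1.
apply: (@le_trans _ _
    (\sum_(s in draws T r) expR (- a) * trace_exp (th *: sample_gram v s))).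
  apply: card_le_sum => s _; first by rewrite mulr_ge0 ?expR_ge0.
  by move=> /ltW; rewrite expRN mulrC ler_pdivlMr ?expR_gt0 // mul1r.
rewrite -mulr_sumr.
apply: le_trans (ler_wpM2l (expR_ge0 _) (sum_trace_exp_sample_gram th)) _.
rewrite mulrCA ler_wpM2l // mulrCA ler_wpM2l // -expRD ler_expR.
have sqr_thE : th ^+ 2 * beta = eta ^+ 2 / 4 / beta.
  have : (th * beta) ^+ 2 = (eta / 2) ^+ 2 by rewrite -th_eta real_normK // num_real.
  by move=> sqrE; apply: (mulIf (lt0r_neq0 beta_gt0)); rewrite divfK ?gt_eqF //; lra.
have rate_le : chernoff_rate beta th <= th + eta ^+ 2 / 4 / beta.
  by rewrite -sqr_thE chernoff_rate_le // th_eta; lra.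
rewrite /a !invfM; lra.
Qed.

Lemma card_not_near_identity (eta : R) : 0 < eta <= 1 / 2 ->
  #|[set s in draws T r | ~~ `[< near_identity eta (sample_gram v s) >]]|%:R
    <= #|draws T r|%:R * (2 * d%:R * expR (- (eta ^+ 2 / (4 * beta)))).
Proof.
move=> /andP[eta_gt0 eta_le]; pose th := eta / 2 / beta.
have th_gt0 : 0 < th by rewrite !divr_gt0.
have thE : `|th * beta| = eta / 2 by rewrite divfK ?gt_eqF // gtr0_norm // divr_gt0.
have NthE : `|- th * beta| = eta / 2 by rewrite mulNr normrN.
have tail := card_trace_exp_tail thE eta_le.
have Ntail := card_trace_exp_tail NthE eta_le.
have -> : #|draws T r|%:R * (2 * d%:R * expR (- (eta ^+ 2 / (4 * beta))))
    = #|draws T r|%:R * (d%:R * expR (- (eta ^+ 2 / (4 * beta))))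
      + #|draws T r|%:R * (d%:R * expR (- (eta ^+ 2 / (4 * beta)))) by ring.
apply: le_trans (lerD tail Ntail); rewrite -natrD ler_nat.
apply: leq_trans (leq_card_setU _ _); apply: subset_leq_card.
apply/fintype.subsetP => s; rewrite !inE => /andP[-> /=]; apply: contraR.
rewrite negb_or -!leNgt => /andP[upper lower]; apply/asboolP.
apply: (near_identity_trace_exp (psd_sample_gram s).1 th_gt0).
  rewrite (_ : th * (1 + eta) = th + eta ^+ 2 / (2 * beta)) //.
  by rewrite /th; field; rewrite gt_eqF.
rewrite (_ : - th * (1 - eta) = - th + eta ^+ 2 / (2 * beta)) //.
by rewrite /th; field; rewrite gt_eqF.
Qed.

End Chernoff.

(** * Rademacher sums *)

Section Coercive.
Variables (R : realFieldType) (d : nat) (w : R).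
Hypothesis w_gt0 : 0 < w.
Implicit Types (B M : 'M[R]_d) (a x y : 'cV[R]_d).

Definition coercive B : Prop :=
  B^T = B /\ forall x, w * dot x x <= dot x (B *m x).

Lemma coercive_scalar : coercive w%:M.
Proof. by split=> [|x]; rewrite ?tr_scalar_mx // mul_scalar_mx dotZr. Qed.

Lemma coerciveD_psd B M : coercive B -> psd M -> coercive (B + M).
Proof.
move=> [symB B_ge] [symM M_ge0]; split; first by rewrite linearD /= symB symM.
by move=> x; rewrite mulmxDl dotDr -[leLHS]addr0 lerD.
Qed.

Lemma coercive_unit B : coercive B -> B \in unitmx.
Proof.
move=> [symB B_ge]; rewrite -row_free_unit; apply: inj_row_free => u uB.
have Bu : B *m u^T = 0 by rewrite -{1}symB -trmx_mul uB trmx0.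
have := B_ge u^T; rewrite Bu dot0r pmulr_rle0 // => u_le0.
have : dot u^T u^T == 0 by rewrite eq_le u_le0 dot_ge0.
by rewrite dot_eq0 trmx_eq0 => /eqP.
Qed.

Lemma dot_invmx_le B x : coercive B -> dot x (invmx B *m x) <= dot x x / w.
Proof.
move=> coB; set z := invmx B *m x.
have Bz : B *m z = x by rewrite mulKVmx // coercive_unit.
have z_le := coB.2 z; rewrite Bz dotC in z_le.
have := dot_ge0 (w *: z - x).
rewrite !(dotBl, dotBr, dotZl, dotZr) (dotC z x) => square_ge0.
by rewrite ler_pdivlMr //; have := ler_wpM2l (ltW w_gt0) z_le; lra.
Qed.

(* [dot y (invmx B y)] is the maximum over [x] of [2 x.y - x.Bx]. *)
Lemma dot_invmx_addD_outer_le B a y : coercive B ->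
  dot y (invmx (B + outer a) *m y) + dot a (invmx (B + outer a) *m y) ^+ 2
    <= dot y (invmx B *m y).
Proof.
move=> coB; set x := invmx (B + outer a) *m y; set z := invmx B *m y.
have Bz : B *m z = y by rewrite mulKVmx // coercive_unit.
have Bx : B *m x = y - dot a x *: a.
  rewrite -mul_outer -(mulKVmx (coercive_unit (coerciveD_psd coB (psd_outer a))) y).
  by rewrite -/x mulmxDl addrK.
have : 0 <= dot (z - x) (B *m (z - x)).
  by apply: le_trans (coB.2 _); rewrite mulr_ge0 ?dot_ge0 // ltW.
have zy : dot z y - dot a x * dot z a = dot y x.
  by rewrite -dotZr -dotBr -Bx dot_mulmx_tr coB.1 Bz.
rewrite mulmxBr Bz Bx !(dotBl, dotBr, dotZl, dotZr).
by rewrite !(dotC x y) !(dotC z y) !(dotC x a) in zy *; nra.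
Qed.

End Coercive.

Lemma expR_dot_signs_le (R : realType) d (w : R) (B : 'M[R]_d) (a y : 'cV[R]_d) :
  0 < w -> coercive w B ->
  expR (dot (y + a) (invmx (B + outer a) *m (y + a)) / 2)
      + expR (dot (y - a) (invmx (B + outer a) *m (y - a)) / 2)
    <= 2 * (expR (dot a a / w / 2) * expR (dot y (invmx B *m y) / 2)).
Proof.
move=> w_gt0 coB; have coBa := coerciveD_psd coB (psd_outer a).
have symBa : (invmx (B + outer a))^T = invmx (B + outer a) by rewrite trmx_inv coBa.1.
have a_le := dot_invmx_le w_gt0 a coBa.
have y_le := dot_invmx_addD_outer_le w_gt0 a y coB.
rewrite !dot_symD // mulmxN !(dotNl, dotNr) opprK.
set qy := dot y _ in y_le *; set qa := dot a _ in a_le *; set c := dot a _ in y_le *.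
have -> : expR ((qy + qa + 2 * c) / 2) + expR ((qy + qa + 2 * - c) / 2)
    = expR ((qy + qa) / 2) * (expR c + expR (- c)).
  by rewrite mulrDr -!expRD; congr (expR _ + expR _); field.
apply: le_trans (ler_wpM2l (expR_ge0 _) (expR_add_expRN_le c)) _.
by rewrite mulrCA ler_pM2l // -!expRD ler_expR; lra.
Qed.

Section Rademacher.
Variables (R : realType) (N d : nat) (a : 'I_N -> 'cV[R]_d).
Local Notation signs := {ffun 'I_N -> bool}.
Implicit Types (e : signs) (k : nat).

Definition flip (k : 'I_N) e : signs := [ffun i => (i == k) (+) e i].

Lemma flipK (k : 'I_N) : involutive (flip k).
Proof. by move=> e; apply/ffunP => i; rewrite !ffunE addbA addbb. Qed.

Lemma sum_flip_le (k : 'I_N) (F G : signs -> R) :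
  (forall e, F e + F (flip k e) <= 2 * G e) -> \sum_e F e <= \sum_e G e.
Proof.
move=> FG; have sum_flip : \sum_e F (flip k e) = \sum_e F e.
  by rewrite [RHS](reindex_inj (inv_inj (flipK k))).
have := ler_sum (index_enum _) (fun e (_ : predT e) => FG e).
by rewrite big_split /= sum_flip -mulr_sumr; lra.
Qed.

Definition signed_sum e : 'cV[R]_d := \sum_i (-1) ^+ e i *: a i.

Definition partial_signed_sum k e : 'cV[R]_d :=
  \sum_(i < N | (i < k)%N) (-1) ^+ e i *: a i.

Lemma partial_signed_sumS (k : 'I_N) e :
  partial_signed_sum k.+1 e = partial_signed_sum k e + (-1) ^+ e k *: a k.
Proof. exact: sum_ord_ltS. Qed.

Lemma partial_signed_sum_flip (k : 'I_N) e :
  partial_signed_sum k.+1 (flip k e) = partial_signed_sum k e - (-1) ^+ e k *: a k.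
Proof.
rewrite partial_signed_sumS ffunE eqxx signrN scaleNr; congr (_ - _).
by apply: eq_bigr => i i_lt; rewrite ffunE -val_eqE /= ltn_eqF.
Qed.

Definition shifted_gram (w : R) k : 'M[R]_d := w%:M + \sum_(i < N | (i < k)%N) outer (a i).

Definition rademacher_potential w k e : R :=
  expR (dot (partial_signed_sum k e) (invmx (shifted_gram w k) *m partial_signed_sum k e) / 2).

Lemma rademacher_potential_flip_le w (k : 'I_N) e : 0 < w ->
  rademacher_potential w k.+1 e + rademacher_potential w k.+1 (flip k e)
    <= 2 * (expR (dot (a k) (a k) / w / 2) * rademacher_potential w k e).
Proof.
move=> w_gt0; pose b := (-1) ^+ e k *: a k.
have outer_b : outer b = outer (a k) by rewrite outerZ sqrr_sign scale1r.
have -> : dot (a k) (a k) = dot b b by rewrite -!mxtrace_outer outer_b.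
rewrite /rademacher_potential partial_signed_sumS partial_signed_sum_flip.
rewrite /shifted_gram sum_ord_ltS addrA -outer_b.
apply: expR_dot_signs_le w_gt0 _.
exact: coerciveD_psd (coercive_scalar d w) (psd_sum_outer _ _).
Qed.

Lemma sum_rademacher_potential_le w k : 0 < w -> (k <= N)%N ->
  \sum_e rademacher_potential w k e
    <= expR ((\sum_(i < N | (i < k)%N) dot (a i) (a i)) / w / 2) * (2 ^ N)%:R.
Proof.
move=> w_gt0; elim: k => [|k IH] k_le.
  rewrite (eq_bigr (fun=> 1)) => [|e _].
    by rewrite sumr_const card_ffun card_bool card_ord big_pred0 // !mul0r expR0 mul1r.
  by rewrite /rademacher_potential /partial_signed_sum big_pred0 // dot0l mul0r expR0.
rewrite (sum_ord_ltS _ (Ordinal k_le)) !mulrDl addrC expRD -mulrA.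
apply: le_trans (ler_wpM2l (expR_ge0 _) (IH (ltnW k_le))).
rewrite mulr_sumr; apply: (sum_flip_le (k := Ordinal k_le)) => e.
exact: (rademacher_potential_flip_le (Ordinal k_le)).
Qed.

Hypothesis sum_a : \sum_i outer (a i) = 1%:M.

Lemma sum_expR_signed_sum mu : 0 < mu < 1 ->
  \sum_e expR (mu / 2 * dot (signed_sum e) (signed_sum e))
    <= (2 ^ N)%:R * expR (mu / 2 * (d%:R / (1 - mu))).
Proof.
move=> /andP[mu_gt0 mu_lt1]; pose w := mu^-1 - 1.
have w_gt0 : 0 < w by rewrite subr_gt0 invf_gt1.
have potentialE e : rademacher_potential w N e
    = expR (mu / 2 * dot (signed_sum e) (signed_sum e)).
  have -> : signed_sum e = partial_signed_sum N e by apply: eq_bigl => i; rewrite ltn_ord.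
  rewrite /rademacher_potential /shifted_gram (eq_bigl predT) => [|i]; last by rewrite ltn_ord.
  rewrite sum_a -raddfD /= subrK invmx_scalar invrK mul_scalar_mx dotZr.
  by congr expR; ring.
rewrite -(eq_bigr _ (fun e _ => potentialE e)).
apply: le_trans (sum_rademacher_potential_le w_gt0 (leqnn N)) _.
have -> : \sum_(i < N | (i < N)%N) dot (a i) (a i) = d%:R.
  rewrite -[RHS](mxtrace_scalar d 1) -sum_a raddf_sum.
  by apply: eq_big => i; rewrite ?ltn_ord //= mxtrace_outer.
rewrite mulrC ler_pM2l ?ltr0n ?expn_gt0 // ler_expR.
rewrite (_ : _ / w / 2 = mu / 2 * (d%:R / (1 - mu))) //.
by rewrite /w; field; apply/andP; split; lra.
Qed.

Lemma rademacher_tail (t : R) : (0 < d)%N -> 0 < t ->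
  #|[set e | (Num.sqrt d%:R + Num.sqrt (2 * t)) ^+ 2
      < dot (signed_sum e) (signed_sum e)]|%:R <= (2 ^ N)%:R * expR (- t).
Proof.
move=> d_gt0 t_gt0; set g := Num.sqrt d%:R; set u := Num.sqrt (2 * t).
have g_gt0 : 0 < g by rewrite sqrtr_gt0 ltr0n.
have u_gt0 : 0 < u by rewrite sqrtr_gt0; lra.
have gE : d%:R = g ^+ 2 by rewrite sqr_sqrtr.
have uE : t = u ^+ 2 / 2 by rewrite sqr_sqrtr; lra.
pose mu := u / (g + u).
have mu01 : 0 < mu < 1 by rewrite divr_gt0 ?addr_gt0 //= ltr_pdivrMr ?addr_gt0 //; lra.
have mu2_gt0 : 0 < mu / 2 by case/andP: mu01 => mu_gt0 _; rewrite divr_gt0.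
have exponentE : mu / 2 * (d%:R / (1 - mu)) = mu / 2 * (g + u) ^+ 2 - t.
  by rewrite gE uE /mu; field; rewrite addrK !gt_eqF ?addr_gt0.
apply: (@le_trans _ _ (\sum_e expR (mu / 2 * dot (signed_sum e) (signed_sum e)
    - mu / 2 * (g + u) ^+ 2))).
  apply: (card_le_sum (P := predT)) => e _; first exact: expR_ge0.
  move=> e_gt; rewrite -[leLHS]expR0 ler_expR -mulrBr.
  by apply: mulr_ge0; rewrite ?subr_ge0 ltW.
under eq_bigr do rewrite expRD; rewrite -mulr_suml.
apply: le_trans (ler_wpM2r (expR_ge0 _) (sum_expR_signed_sum mu01)) _.
by rewrite exponentE -[leLHS]mulrA -expRD addrAC subrr add0r.
Qed.

End Rademacher.

(** * Sketched least squares *)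

Section Norms.
Variable R : realType.

Lemma norm2E n (v : 'cV[R]_n) : norm2 v = Num.sqrt (dot v v).
Proof. by congr Num.sqrt; apply: eq_bigr => i _; rewrite expr2. Qed.

Lemma norm2_ge0 n (v : 'cV[R]_n) : 0 <= norm2 v.
Proof. exact: sqrtr_ge0. Qed.

Lemma sqr_norm2 n (v : 'cV[R]_n) : norm2 v ^+ 2 = dot v v.
Proof. by rewrite norm2E sqr_sqrtr // dot_ge0. Qed.

Lemma norm20 n : norm2 (0 : 'cV[R]_n) = 0.
Proof. by rewrite norm2E dot0r sqrtr0. Qed.

Lemma norm2Z n c (v : 'cV[R]_n) : norm2 (c *: v) = `|c| * norm2 v.
Proof. by rewrite !norm2E dotZl dotZr mulrA -expr2 sqrtrM ?sqr_ge0 // sqrtr_sqr. Qed.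

Lemma norm2N n (v : 'cV[R]_n) : norm2 (- v) = norm2 v.
Proof. by rewrite -scaleN1r norm2Z normrN normr1 mul1r. Qed.

Lemma norm2_le_sqrtM n k (u : 'cV[R]_n) (v : 'cV[R]_k) c : 0 <= c ->
  dot u u <= c * dot v v -> norm2 u <= Num.sqrt c * norm2 v.
Proof. by move=> c_ge0 uv; rewrite !norm2E -sqrtrM // ler_wsqrtr. Qed.

Lemma dot_mulmx_le_frobenius m n (M : 'M[R]_(m, n)) (x : 'cV[R]_n) :
  dot (M *m x) (M *m x) <= \tr (gram M) * dot x x.
Proof.
rewrite -sum_outer_row raddf_sum mulr_suml; apply: ler_sum => i _ /=.
rewrite mxtrace_outer -expr2 (_ : (M *m x) i 0 = dot (row i M)^T x).
  exact: dot_CauchySchwarz.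
by rewrite mxE; apply: eq_bigr => j _; rewrite !mxE.
Qed.

Lemma norm2_le_specnorm m n (M : 'M[R]_(m, n)) (x : 'cV[R]_n) :
  norm2 x <= 1 -> norm2 (M *m x) <= specnorm M.
Proof.
move=> x_le1; apply: ub_le_sup; last by exists x.
exists (Num.sqrt (\tr (gram M))) => _ [y /= y_le1 <-].
have tr_ge0 : 0 <= \tr (gram M).
  by rewrite -sum_outer_row raddf_sum sumr_ge0 // => i _; rewrite /= mxtrace_outer dot_ge0.
apply: le_trans (norm2_le_sqrtM tr_ge0 (dot_mulmx_le_frobenius M y)) _.
by rewrite ler_piMr ?sqrtr_ge0.
Qed.

Lemma specnorm_ge0 m n (M : 'M[R]_(m, n)) : 0 <= specnorm M.
Proof. by have := @norm2_le_specnorm _ _ M 0; rewrite mulmx0 !norm20 ler01; apply. Qed.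

Lemma norm2_mulmx_le m n (M : 'M[R]_(m, n)) (x : 'cV[R]_n) :
  norm2 (M *m x) <= specnorm M * norm2 x.
Proof.
have [->|x_neq0] := eqVneq x 0; first by rewrite mulmx0 !norm20 mulr0.
have x_gt0 : 0 < norm2 x by rewrite norm2E sqrtr_gt0 dot_gt0.
have xV_ge0 : 0 <= (norm2 x)^-1 by rewrite invr_ge0 norm2_ge0.
rewrite -ler_pdivrMr // mulrC -(ger0_norm xV_ge0) -norm2Z scalemxAr.
by apply: norm2_le_specnorm; rewrite norm2Z ger0_norm // mulVf // gt_eqF.
Qed.

End Norms.

Section LinearAlgebra.
Variable R : realType.

Lemma orthonormal_factorization m k (F : 'M[R]_(m, k)) :
  exists d (W : 'M[R]_(m, d)) (T : 'M[R]_(d, k)),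
    [/\ d = \rank F, gram W = 1%:M & F = W *m T].
Proof.
have [F0 [G0 [F_eq /gram_unit unitG]]] : exists (F0 : 'M_(m, \rank F)) (G0 : 'M_(\rank F, k)),
    F = F0 *m G0 /\ \rank F0 = \rank F.
  exists (col_base F), (row_base F); rewrite mulmx_base.
  by split=> //; apply/eqP; exact: col_base_full.
have [P [l decG]] := spectral_theorem (tr_gram F0).
have l_gt0 i : 0 < l 0 i.
  rewrite lt_def (psd_spectral_ge0 decG i (psd_gram F0)) andbT.
  have [unitPT unitP] := mulmx1_unit decG.1.
  have : diag_mx l \in unitmx.
    by rewrite -(spectral_decomp_diag decG) !unitmx_mul unitP unitPT andbT.
  by rewrite unitmxE det_diag unitfE => /prodf_neq0; apply.
pose sqrtl := \row_i Num.sqrt (l 0 i); pose sqrtVl := \row_i (Num.sqrt (l 0 i))^-1.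
have sqrtl_neq0 i : Num.sqrt (l 0 i) != 0 by rewrite gt_eqF // sqrtr_gt0.
have sqrtK : diag_mx sqrtVl *m diag_mx sqrtl = 1%:M.
  by rewrite mulmx_diag -diag_const_mx; congr diag_mx; apply/rowP => i; rewrite !mxE mulVf.
have lE : diag_mx l = diag_mx sqrtl *m diag_mx sqrtl.
  rewrite mulmx_diag; congr diag_mx; apply/rowP => i; rewrite !mxE.
  by rewrite -expr2 sqr_sqrtr // ltW.
exists (\rank F), (F0 *m (P^T *m diag_mx sqrtVl)), (diag_mx sqrtl *m P *m G0).
split=> //.
  rewrite gram_mulmx trmx_mul trmxK tr_diag_mx.
  transitivity (diag_mx sqrtVl *m (P *m gram F0 *m P^T) *m diag_mx sqrtVl).
    by rewrite !mulmxA.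
  rewrite (spectral_decomp_diag decG) lE mulmxA sqrtK mul1mx; exact: mulmx1C.
by rewrite -!mulmxA (mulmxA (diag_mx sqrtVl)) sqrtK mul1mx (mulmxA P^T) decG.1 mul1mx.
Qed.

Lemma pseudoinverse_mulmx m n (F : 'M[R]_(m, n)) : \rank F = n ->
  pseudoinverse F *m F = 1%:M.
Proof.
move=> /gram_unit unitF; have [FXF _ _ _] := pseudoinverseP F.
by apply: (can_inj (mulKmx unitF)); rewrite mulmx1 -!mulmxA [F *m _]mulmxA FXF.
Qed.

Lemma normal_equations m n (F : 'M[R]_(m, n)) (c : 'cV[R]_m) :
  F^T *m (c - F *m (pseudoinverse F *m c)) = 0.
Proof.
have [FXF _ symFX _] := pseudoinverseP F.
by rewrite mulmxBr !mulmxA -[F^T *m F *m _]mulmxA -symFX -trmx_mul FXF subrr.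
Qed.

Lemma left_singular_vectors_proj m n (A U : 'M[R]_(m, n)) :
  \rank A = n -> left_singular_vectors A U -> U *m U^T = A *m pseudoinverse A.
Proof.
move=> rankA [s [V [orthU _ _ AU]]]; have [AXA _ symAX _] := pseudoinverseP A.
set N := diag_mx s *m V^T; have AN : A = U *m N by rewrite AU -mulmxA.
have unitN : N \in unitmx.
  rewrite -row_full_unit /row_full eqn_leq rank_leq_col /= -[X in (X <= _)%N]rankA.
  by rewrite [in X in (X <= _)%N]AN mxrankM_maxr.
set Pr := A *m pseudoinverse A in AXA symAX *.
have PrU : Pr *m U = U by apply: (can_inj (mulmxK unitN)); rewrite -mulmxA -AN.
have UPr : U^T *m Pr = U^T by rewrite -symAX -trmx_mul PrU.
have PrE : Pr = U *m (N *m pseudoinverse A) by rewrite mulmxA -AN.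
by rewrite -UPr PrE [U^T *m _]mulmxA orthU mul1mx.
Qed.

End LinearAlgebra.

Section LeastSquares.
Variables (R : realType) (m n : nat) (A : 'M[R]_(m, n)) (b : 'cV[R]_m).

Let x_opt := pseudoinverse A *m b.
Let residual := b - A *m x_opt.

Lemma residual_orth (z : 'cV[R]_n) : dot (A *m z) residual = 0.
Proof. by rewrite dotC dot_mulmx_tr normal_equations dot0l. Qed.

Lemma norm2_residual_le gamma : 0 < gamma <= 1 ->
  norm2 (A *m x_opt) = gamma * norm2 b ->
  norm2 residual <= Num.sqrt (gamma ^- 2 - 1) * norm2 (A *m x_opt).
Proof.
move=> /andP[gamma_gt0 gamma_le1] norm_proj.
have gammaV_ge1 : 1 <= gamma ^- 2 by rewrite -exprVn exprn_ege1 // invf_ge1.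
apply: norm2_le_sqrtM; first by rewrite subr_ge0.
have proj_b : dot (A *m x_opt) (A *m x_opt) = gamma ^+ 2 * dot b b.
  by rewrite -!sqr_norm2 norm_proj exprMn.
have b_split : dot b b = dot (A *m x_opt) (A *m x_opt) + dot residual residual.
  by rewrite -dotD_orth ?residual_orth // addrC subrK.
rewrite -(addKr (dot (A *m x_opt) (A *m x_opt)) (dot residual residual)) -b_split proj_b.
by rewrite (_ : _ + _ = (gamma ^- 2 - 1) * (gamma ^+ 2 * dot b b)) //; field; rewrite gt_eqF.
Qed.

Variables (r d : nat) (Th : 'M[R]_(r, m)) (W : 'M[R]_(m, d)).
Variables (TA : 'M[R]_(d, n)) (tb : 'cV[R]_d) (eta : R).
Hypotheses (orthW : gram W = 1%:M) (AE : A = W *m TA) (bE : b = W *m tb).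
Hypotheses (eta01 : 0 < eta < 1) (nearTh : near_identity eta (gram (Th *m W))).

Let x_sketch := pseudoinverse (Th *m A) *m (Th *m b).
Let error := A *m (x_sketch - x_opt).

Let eta_gt0 : 0 < eta. Proof. by case/andP: eta01. Qed.
Let onem_sqr_eta_gt0 : 0 < 1 - eta ^+ 2.
Proof. by rewrite subr_gt0 expr_lt1 // ?(ltW eta_gt0) //; case/andP: eta01. Qed.

Lemma dot_sketch_error_le :
  dot error error <= eta ^+ 2 / (1 - eta ^+ 2) * dot residual residual.
Proof.
have [e eE] : exists e, error = W *m e.
  by exists (TA *m (x_sketch - x_opt)); rewrite mulmxA -AE.
have [s sE] : exists s, residual = W *m s.
  by exists (tb - TA *m x_opt); rewrite mulmxBr -bE mulmxA -AE.
have nearS := nearTh; set S := gram _ in nearS; have symS : S^T = S := tr_gram _.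
have normal_eq : dot e (S *m (s - e)) = 0.
  have -> : S *m (s - e) = (Th *m W)^T *m (Th *m b - Th *m A *m x_sketch).
    rewrite /S /gram -mulmxA -[Th *m W *m _]mulmxA mulmxBr -eE -sE.
    rewrite -[Th *m A *m _]mulmxA -mulmxBr; congr (_ *m (_ *m _)).
    by rewrite /residual /error mulmxBr opprB addrA subrK.
  rewrite dot_mulmx_tr trmxK -[Th *m W *m e]mulmxA -eE /error mulmxA dotC dot_mulmx_tr.
  by rewrite normal_equations dot0l.
have orth : dot e s = 0 by rewrite -(dot_orthonormal _ _ orthW) -eE -sE residual_orth.
rewrite eE sE !(dot_orthonormal _ _ orthW).
(* The scaling by [eta] balances the two squares in [near_identity_dot]. *)
have := near_identity_dot e (eta *: (s - e)) symS nearS.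
rewrite -scalemxAr !(dotZl, dotZr) normal_eq !(dotBl, dotBr) (dotC s e) orth => error_le.
rewrite mulrAC ler_pdivlMr // -(ler_pM2l eta_gt0); lra.
Qed.

Lemma norm2_sketch_residual_le c : 0 <= c -> (1 - eta ^+ 2)^-1 <= c ^+ 2 ->
  norm2 (A *m x_sketch - b) <= c * norm2 (A *m x_opt - b).
Proof.
move=> c_ge0 c_ge.
have -> : A *m x_sketch - b = error - residual.
  by rewrite /error /residual mulmxBr opprB addrA subrK.
have -> : A *m x_opt - b = - residual by rewrite opprB.
rewrite norm2N -(ger0_norm c_ge0) -sqrtr_sqr.
apply: norm2_le_sqrtM; first exact: sqr_ge0.
rewrite dotD_orth ?dotNr ?residual_orth ?oppr0 // dotNl opprK.
apply: le_trans (ler_wpM2r (dot_ge0 _) c_ge).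
rewrite (_ : (1 - eta ^+ 2)^-1 = eta ^+ 2 / (1 - eta ^+ 2) + 1).
  by rewrite mulrDl mul1r lerD2r dot_sketch_error_le.
by field; rewrite gt_eqF.
Qed.

Lemma norm2_sketch_solution_le U gamma c : \rank A = n ->
  left_singular_vectors A U -> 0 < gamma <= 1 ->
  norm2 (U *m U^T *m b) = gamma * norm2 b ->
  eta ^+ 2 / (1 - eta ^+ 2) <= c ->
  norm2 (x_opt - x_sketch)
    <= Num.sqrt c * cond2 A * Num.sqrt (gamma ^- 2 - 1) * norm2 x_opt.
Proof.
move=> rankA svU gamma01; rewrite (left_singular_vectors_proj rankA svU) -mulmxA.
move=> norm_proj c_ge.
have c_ge0 : 0 <= c by apply: le_trans c_ge; rewrite divr_ge0 ?sqr_ge0 // ltW.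
have error_le : norm2 error <= Num.sqrt c * norm2 residual.
  apply: norm2_le_sqrtM => //; apply: le_trans dot_sketch_error_le _.
  by rewrite ler_wpM2r // dot_ge0.
have -> : x_opt - x_sketch = - (pseudoinverse A *m error).
  by rewrite /error mulmxA pseudoinverse_mulmx // mul1mx opprB.
rewrite norm2N; apply: le_trans (norm2_mulmx_le _ _) _.
rewrite (_ : _ * norm2 x_opt = specnorm (pseudoinverse A) *
    (Num.sqrt c * (Num.sqrt (gamma ^- 2 - 1) * (specnorm A * norm2 x_opt)))); last first.
  by rewrite /cond2; ring.
rewrite ler_wpM2l ?specnorm_ge0 //; apply: le_trans error_le _.
rewrite ler_wpM2l ?sqrtr_ge0 //; apply: le_trans (norm2_residual_le gamma01 norm_proj) _.
by rewrite ler_wpM2l ?sqrtr_ge0 // norm2_mulmx_le.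
Qed.

End LeastSquares.

(** * The subsampled randomized Hadamard transform *)

Section Hadamard.
Variable R : realType.

Lemma hadamard_sqr p i j : hadamard R p i j ^+ 2 = 1.
Proof.
elim: p i j => [|p IH] i j.
  by rewrite /= mxE (ord1 (i : 'I_1)) (ord1 (j : 'I_1)) eqxx expr1n.
rewrite /= castmxE /block_mx mxE; case: splitP => i' _; rewrite mxE;
  by case: splitP => j' _; rewrite ?mxE ?sqrrN IH.
Qed.

Lemma gram_castmx m n (e : m = n) (A : 'M[R]_m) :
  gram (castmx (e, e) A) = castmx (e, e) (gram A).
Proof. by case: n / e; rewrite !castmx_id. Qed.

Lemma castmx_scalar m n (e : m = n) (c : R) : castmx (e, e) c%:M = c%:M.
Proof. by case: n / e; rewrite castmx_id. Qed.

Lemma gram_hadamard p : gram (hadamard R p) = (2 ^ p)%:R%:M.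
Proof.
elim: p => [|p IH]; first by rewrite /gram /= trmx1 mulmx1 expn0.
have trN : (- hadamard R p)^T = - (hadamard R p)^T by exact: linearN.
rewrite /= gram_castmx /gram tr_block_mx mulmx_block trN !(mulmxN, mulNmx) opprK.
rewrite -/(gram _) IH subrr.
have -> : (2 ^ p)%:R%:M + (2 ^ p)%:R%:M = (2 ^ p.+1)%:R%:M :> 'M[R]_(2 ^ p).
  by rewrite -raddfD -natrD double_pow2.
by rewrite -scalar_mx_block castmx_scalar.
Qed.

Lemma gram_normalized_hadamard p : gram (normalized_hadamard R p) = 1%:M.
Proof.
have p_gt0 : 0 < (2 ^ p)%:R :> R by rewrite ltr0n expn_gt0.
rewrite gramZ gram_hadamard scale_scalar_mx exprVn sqr_sqrtr ?ltW //.
by rewrite mulVf // gt_eqF.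
Qed.

Lemma gram_sign_mx N (e : {ffun 'I_N -> bool}) : gram (sign_mx R e) = 1%:M.
Proof.
rewrite /gram tr_diag_mx mulmx_diag -diag_const_mx; congr diag_mx.
by apply/rowP => j; rewrite !mxE -expr2 sqrr_sign.
Qed.

End Hadamard.

Section SrhtProb.
Variables (R : realType) (r N : nat).
Hypothesis r_le : (r <= N)%N.
Implicit Types E F : pred (srht_outcome r N).

Lemma srht_prob_ge0 E : 0 <= srht_prob R E.
Proof. by rewrite divr_ge0. Qed.

Lemma card_srht_space : #|srht_space r N| = (2 ^ N * #|draws 'I_N r|)%N.
Proof.
have -> : srht_space r N = finset.setX [set: {ffun 'I_N -> bool}] (draws 'I_N r).
  by apply/setP => -[e s]; rewrite !inE.
by rewrite cardsX cardsT card_ffun card_bool card_ord.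
Qed.

Lemma card_draws_gt0 : (0 < #|draws 'I_N r|)%N.
Proof.
apply/card_gt0P; exists [ffun i => widen_ord r_le i]; rewrite inE.
by apply/injectiveP => i j; rewrite !ffunE => /(congr1 val) /= ij; exact: val_inj.
Qed.

Lemma srht_prob_ge_onem E F c : (forall w, ~~ F w -> E w) ->
  srht_prob R F <= c -> 1 - c <= srht_prob R E.
Proof.
move=> FE; have space_gt0 : 0 < #|srht_space r N|%:R :> R.
  by rewrite ltr0n card_srht_space muln_gt0 expn_gt0 card_draws_gt0.
rewrite ler_pdivrMr // ler_pdivlMr // mulrBl mul1r => F_le.
rewrite lerBlDr; apply: le_trans (lerD (lexx _) F_le).
rewrite -natrD ler_nat; apply: leq_trans (leq_card_setU _ _).
apply: subset_leq_card; apply/fintype.subsetP => w; rewrite !inE => -> /=.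
by have [_|/FE ->] := boolP (F w); rewrite ?orbT.
Qed.

Lemma srht_prob_le_signs E (good : pred {ffun 'I_N -> bool}) (c c' : R) : 0 <= c ->
  #|[set e | ~~ good e]|%:R <= (2 ^ N)%:R * c' ->
  (forall e, good e ->
    #|[set s in draws 'I_N r | E (e, s)]|%:R <= #|draws 'I_N r|%:R * c) ->
  srht_prob R E <= c' + c.
Proof.
move=> c_ge0 bad_le good_le; set D : R := #|draws 'I_N r|%:R in good_le *.
have D_gt0 : 0 < D by rewrite ltr0n card_draws_gt0.
rewrite /srht_prob card_srht_space natrM ler_pdivrMr; last first.
  by rewrite mulr_gt0 // ltr0n expn_gt0.
have -> : #|[set w in srht_space r N | E w]|%:R
    = \sum_e #|[set s in draws 'I_N r | E (e, s)]|%:R :> R.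
  under [RHS]eq_bigr do rewrite -sum1_card natr_sum.
  rewrite -sum1_card natr_sum pair_big_dep /=.
  by apply: eq_bigl => -[e s]; rewrite !inE.
apply: (@le_trans _ _ (\sum_e D * (c + (~~ good e)%:R))).
  apply: ler_sum => e _; have [/good_le|_] := boolP (good e); first by rewrite addr0.
  apply: (@le_trans _ _ D); last by rewrite ler_peMr ?(ltW D_gt0) // lerDr.
  rewrite ler_nat subset_leq_card //.
  by apply/fintype.subsetP => s; rewrite inE => /andP[].
have sum_bad : \sum_e (~~ good e)%:R = #|[set e | ~~ good e]|%:R :> R.
  rewrite -sum1_card natr_sum [RHS]big_mkcond; apply: eq_bigr => e _.
  by rewrite inE; case: (good e).
rewrite -mulr_sumr big_split /= sumr_const card_ffun card_bool card_ord sum_bad -mulr_natl.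
by have := ler_wpM2l (ltW D_gt0) bad_le; lra.
Qed.

End SrhtProb.

Section Embedding.
Variables (R : realType) (p d r : nat) (W : 'M[R]_(2 ^ p, d)).
Local Notation m := (2 ^ p)%N.
Local Notation signs := {ffun 'I_m -> bool}.
Hypotheses (orthW : gram W = 1%:M) (d_gt0 : (0 < d)%N) (r_gt0 : (0 < r)%N).
Hypothesis r_le : (r <= m)%N.
Implicit Types (e : signs) (j : 'I_m).

Let m_gt0 : 0 < m%:R :> R. Proof. by rewrite ltr0n expn_gt0. Qed.
Let rR_gt0 : 0 < r%:R :> R. Proof. by rewrite ltr0n. Qed.

Definition sketch_rows e : 'M[R]_(m, d) :=
  Num.sqrt (m%:R / r%:R) *: (normalized_hadamard R p *m sign_mx R e *m W).

Definition sketch_vec e j : 'cV[R]_d := (row j (sketch_rows e))^T.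

Lemma gram_srht_mul (w : srht_outcome r m) :
  gram (srht R w *m W) = sample_gram (sketch_vec w.1) w.2.
Proof.
have -> : srht R w *m W = rowsub w.2 (sketch_rows w.1).
  rewrite /srht /sampling_mx -scalemxAl !mul_rowsub_mx mul1mx.
  by apply/matrixP => i j; rewrite !mxE.
by rewrite -sum_outer_row; apply: eq_bigr => i _; rewrite row_rowsub.
Qed.

Lemma sum_outer_sketch_vec e : \sum_j outer (sketch_vec e j) = (m%:R / r%:R)%:M.
Proof.
rewrite sum_outer_row gramZ sqr_sqrtr ?divr_ge0 ?ltW // !gram_mulmx.
rewrite gram_normalized_hadamard mulmx1 -[_ *m sign_mx R e]/(gram _) gram_sign_mx mulmx1.
by rewrite -[_ *m W]/(gram W) orthW scalemx1.
Qed.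

Definition hadamard_atom j (k : 'I_m) : 'cV[R]_d := hadamard R p j k *: (row k W)^T.

Lemma sum_outer_hadamard_atom j : \sum_k outer (hadamard_atom j k) = 1%:M.
Proof.
rewrite -orthW -sum_outer_row; apply: eq_bigr => k _.
by rewrite outerZ hadamard_sqr scale1r.
Qed.

Lemma sketch_vecE e j :
  sketch_vec e j = (Num.sqrt r%:R)^-1 *: signed_sum (hadamard_atom j) e.
Proof.
apply/colP => i; rewrite !mxE summxE.
have -> : Num.sqrt (m%:R / r%:R) = Num.sqrt m%:R * (Num.sqrt r%:R)^-1 :> R.
  by rewrite sqrtrM ?sqrtrV // ltW.
rewrite mulrAC [RHS]mulrC; congr (_ * _); rewrite mulr_sumr.
apply: eq_bigr => k _; rewrite mul_mx_diag !mxE.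
by field; rewrite gt_eqF // sqrtr_gt0.
Qed.

Definition flat_signs (c : R) e : bool :=
  [forall j, dot (signed_sum (hadamard_atom j) e) (signed_sum (hadamard_atom j) e) <= c].

Lemma card_not_flat_signs t : 0 < t ->
  #|[set e | ~~ flat_signs ((Num.sqrt d%:R + Num.sqrt (2 * t)) ^+ 2) e]|%:R
    <= (2 ^ m)%:R * (m%:R * expR (- t)) :> R.
Proof.
move=> t_gt0; set c := _ ^+ 2.
pose loud e j :=
  c < dot (signed_sum (hadamard_atom j) e) (signed_sum (hadamard_atom j) e).
have -> : [set e | ~~ flat_signs c e] = [set e | [exists j, loud e j]].
  apply/setP => e; rewrite !inE negb_forall.
  by apply: eq_existsb => j; rewrite -ltNge.
apply: (@le_trans _ _ (\sum_j #|[set e | loud e j]|%:R)).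
  by rewrite -natr_sum ler_nat card_exists_le.
apply: (@le_trans _ _ (\sum_(j < m) (2 ^ m)%:R * expR (- t))).
  by apply: ler_sum => j _; apply: rademacher_tail => //; exact: sum_outer_hadamard_atom.
by rewrite sumr_const card_ord -[leLHS]mulr_natl mulrCA.
Qed.

Lemma dot_sketch_vec_le c e j : flat_signs c e ->
  dot (sketch_vec e j) (sketch_vec e j) <= c / r%:R.
Proof.
move=> /forallP/(_ j) flat; rewrite sketch_vecE dotZl dotZr mulrA -invfM -expr2.
by rewrite sqr_sqrtr ?ler0n // mulrC ler_pM2r ?invr_gt0.
Qed.

Lemma srht_prob_not_near_identity t eta : 0 < t -> 0 < eta <= 1 / 2 ->
  srht_prob R (fun w : srht_outcome r m =>
      ~~ `[< near_identity eta (gram (srht R w *m W)) >])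
    <= m%:R * expR (- t) + 2 * d%:R
       * expR (- (eta ^+ 2 * r%:R / (4 * (Num.sqrt d%:R + Num.sqrt (2 * t)) ^+ 2))).
Proof.
move=> t_gt0 eta_bound.
apply: (srht_prob_le_signs r_le _ (card_not_flat_signs t_gt0)) => [|e flat].
  by rewrite !mulr_ge0 ?expR_ge0.
set c := _ ^+ 2 in flat *.
have c_gt0 : 0 < c by rewrite exprn_gt0 // ltr_wpDr ?sqrtr_ge0 // sqrtr_gt0 ltr0n.
have := card_not_near_identity (divr_gt0 c_gt0 rR_gt0)
  (fun j => dot_sketch_vec_le j flat) _ (sum_outer_sketch_vec e) _ _ eta_bound.
have -> : eta ^+ 2 * r%:R / (4 * c) = eta ^+ 2 / (4 * (c / r%:R)).
  by field; rewrite !gt_eqF.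
rewrite card_ord => card_le.
have -> : [set s in draws _ r | ~~ `[< near_identity eta (gram (srht R (e, s) *m W)) >]]
    = [set s in draws _ r | ~~ `[< near_identity eta (sample_gram (sketch_vec e) s) >]].
  by apply/setP => s; rewrite !inE gram_srht_mul.
by apply: card_le => //; field; rewrite !gt_eqF.
Qed.

End Embedding.

(** * Choice of the parameters *)

Section SampleSize.
Variables (R : realType) (m n r d : nat) (eps delta C : R).
Hypotheses (n_gt0 : (0 < n)%N) (m_gt0 : (0 < m)%N).
Hypotheses (eps_gt0 : 0 < eps) (delta_gt0 : 0 < delta) (delta_le : delta <= 1 / 7).
Hypothesis C_ge1 : 1 <= C.
Local Notation log_m := (ln (m%:R / delta)).
Local Notation log_n := (ln (n%:R / delta)).
Local Notation radius k t := ((Num.sqrt k%:R + Num.sqrt t) ^+ 2).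
Hypothesis r_ge : 6 * C ^+ 2 * eps^-1 * radius n (8 * log_m) * log_n <= r%:R.

Lemma expR_ln_div k : (0 < k)%N -> expR (ln (k%:R / delta)) = k%:R / delta.
Proof. by move=> k_gt0; rewrite lnK // posrE divr_gt0 // ltr0n. Qed.

Lemma ln_div_ge k : (0 < k)%N -> 1 / 2 <= ln (k%:R / delta).
Proof.
move=> k_gt0; have k_ge1 : 1 <= k%:R :> R by rewrite ler1n.
have ratio_gt0 : 0 < delta / k%:R by rewrite divr_gt0 ?ltr0n.
have ratio_le : delta / k%:R <= 1 / 7.
  by rewrite ler_pdivrMr ?ltr0n // (le_trans delta_le) // ler_peMr.
have ratio_gtN1 : -1 < delta / k%:R - 1 by lra.
have := le_ln1Dx ratio_gtN1; rewrite addrC subrK -invf_div lnV; last first.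
  by rewrite posrE divr_gt0 //; lra.
by rewrite invf_div; lra.
Qed.

Lemma radius_gt0 k (t : R) : (0 < k)%N -> 0 < radius k t.
Proof. by move=> k_gt0; rewrite exprn_gt0 // ltr_wpDr ?sqrtr_ge0 // sqrtr_gt0 ltr0n. Qed.

Lemma radius_le : (d <= n.+1)%N -> radius d (2 * log_m) <= radius n (8 * log_m).
Proof.
move=> d_le; have log_ge := ln_div_ge m_gt0.
have -> : Num.sqrt (8 * log_m) = 2 * Num.sqrt (2 * log_m).
  rewrite (_ : 8 * log_m = 2 ^+ 2 * (2 * log_m)); last by ring.
  by rewrite sqrtrM ?sqr_ge0 // sqrtr_sqr ger0_norm.
have sqrt_log_ge1 : 1 <= Num.sqrt (2 * log_m).
  by rewrite -[leLHS]sqrtr1 ler_wsqrtr //; lra.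
have sqrtd_le : Num.sqrt d%:R <= Num.sqrt n%:R + 1 :> R.
  have sqrtn_ge0 := sqrtr_ge0 (n%:R : R).
  rewrite -[leRHS]ger0_norm ?addr_ge0 // -sqrtr_sqr ler_wsqrtr //.
  rewrite sqrrD1 sqr_sqrtr ?ler0n //; apply: (@le_trans _ _ n.+1%:R).
    by rewrite ler_nat.
  by rewrite -natr1; lra.
have sqrtd_ge0 := sqrtr_ge0 (d%:R : R); have sqrtn_ge0 := sqrtr_ge0 (n%:R : R).
by rewrite ler_sqr ?nnegrE; lra.
Qed.

Lemma sample_size_ge : 6 * eps^-1 * radius n (8 * log_m) * log_n <= r%:R.
Proof.
apply: le_trans r_ge; have C2_ge1 : 1 <= C ^+ 2 by rewrite exprn_ege1.
have radius_pos := radius_gt0 (8 * log_m) n_gt0; have log_ge := ln_div_ge n_gt0.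
have prod_ge0 : 0 <= eps^-1 * radius n (8 * log_m) * log_n.
  by rewrite !mulr_ge0 ?invr_ge0 ?(ltW eps_gt0) ?(ltW radius_pos) //; lra.
by have := ler_wpM2r prod_ge0 C2_ge1; lra.
Qed.

Lemma sample_size_gt0 : (0 < r)%N.
Proof.
rewrite -(ltr0n R); apply: lt_le_trans sample_size_ge.
have log_ge := ln_div_ge n_gt0.
apply: mulr_gt0; last by lra.
by apply: mulr_gt0; [rewrite mulr_gt0 ?invr_gt0 | exact: radius_gt0].
Qed.

Lemma failure_probability_le : (0 < d <= n.+1)%N ->
  m%:R * expR (- log_m) + 2 * d%:R
    * expR (- (2 / 3 * eps * r%:R / (4 * radius d (2 * log_m)))) <= 5 * delta.
Proof.
move=> /andP[d_gt0 d_le]; have log_ge := ln_div_ge n_gt0.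
have n_gt0R : 0 < n%:R :> R by rewrite ltr0n.
have -> : m%:R * expR (- log_m) = delta.
  by rewrite expRN expR_ln_div //; field; rewrite !gt_eqF ?ltr0n.
have radius_pos := radius_gt0 (2 * log_m) d_gt0.
have tail_le : expR (- (2 / 3 * eps * r%:R / (4 * radius d (2 * log_m)))) <= delta / n%:R.
  rewrite (_ : delta / n%:R = expR (- log_n)); last by rewrite expRN expR_ln_div // invf_div.
  rewrite ler_expR lerN2 ler_pdivlMr; last by lra.
  have := ler_wpM2l (ltW eps_gt0) sample_size_ge.
  rewrite (_ : eps * _ = 6 * (radius n (8 * log_m) * log_n)); last by field; rewrite gt_eqF.
  have log_ge0 : 0 <= log_n by lra.
  by have := ler_wpM2r log_ge0 (radius_le d_le); lra.
have d_le2n : d%:R <= 2 * n%:R :> R.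
  by rewrite -natrM ler_nat (leq_trans d_le) // mul2n -addnn -add1n leq_add2r.
have := ler_pM (ler0n _ _) (expR_ge0 _) d_le2n tail_le.
rewrite (_ : 2 * n%:R * (delta / n%:R) = 2 * delta); last by field; rewrite gt_eqF.
lra.
Qed.

End SampleSize.

Lemma exists_srht_embedding (R : realType) (p n r : nat)
    (A : 'M[R]_(2 ^ p, n)) (b : 'cV[R]_(2 ^ p)) (eps delta C : R) :
  (0 < n)%N -> \rank A = n -> 0 < eps < 1 / 3 -> 0 < delta <= 1 / 7 -> 1 <= C ->
  6 * C ^+ 2 * eps^-1
    * (Num.sqrt n%:R + Num.sqrt (8 * ln ((2 ^ p)%:R / delta))) ^+ 2
    * ln (n%:R / delta) <= r%:R ->
  (r <= 2 ^ p)%N ->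
  exists d (W : 'M[R]_(2 ^ p, d)) TA tb,
    [/\ gram W = 1%:M, A = W *m TA, b = W *m tb &
      srht_prob R (fun w : srht_outcome r (2 ^ p) =>
        ~~ `[< near_identity (Num.sqrt (2 / 3 * eps)) (gram (srht R w *m W)) >])
      <= 5 * delta].
Proof.
move=> n_gt0 rankA /andP[eps_gt0 eps_lt] /andP[delta_gt0 delta_le] C_ge1 r_ge r_le.
have [d [W [T [dE orthW AbE]]]] := orthonormal_factorization (row_mx A b).
have AE : A = W *m lsubmx T.
  by rewrite -(row_mxKl A b) AbE -[T in LHS]hsubmxK mul_mx_row row_mxKl.
have bE : b = W *m rsubmx T.
  by rewrite -(row_mxKr A b) AbE -[T in LHS]hsubmxK mul_mx_row row_mxKr.
exists d, W, (lsubmx T), (rsubmx T); split => //.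
have d_le : (d <= n.+1)%N by rewrite dE (leq_trans (rank_leq_col _)) ?addn1.
have d_gt0 : (0 < d)%N.
  apply: leq_trans n_gt0 _; rewrite -rankA AE.
  exact: leq_trans (mxrankM_maxl _ _) (rank_leq_col _).
have m_gt0 : (0 < 2 ^ p)%N by rewrite expn_gt0.
have log_gt0 : 0 < ln ((2 ^ p)%:R / delta).
  by have := ln_div_ge delta_gt0 delta_le m_gt0; lra.
have eta_sqr : Num.sqrt (2 / 3 * eps) ^+ 2 = 2 / 3 * eps by rewrite sqr_sqrtr //; lra.
have eta_bound : 0 < Num.sqrt (2 / 3 * eps) <= 1 / 2.
  rewrite sqrtr_gt0; apply/andP; split; first by lra.
  by rewrite -(ler_sqr (x := Num.sqrt _)) ?nnegrE ?sqrtr_ge0 //; lra.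
have r_gt0 := sample_size_gt0 n_gt0 eps_gt0 delta_gt0 delta_le C_ge1 r_ge.
apply: le_trans (srht_prob_not_near_identity orthW d_gt0 r_gt0 r_le log_gt0 eta_bound) _.
rewrite eta_sqr.
apply: (failure_probability_le n_gt0 m_gt0 eps_gt0 delta_gt0 delta_le C_ge1 r_ge).
by rewrite d_gt0.
Qed.

Lemma residual_constant_le (R : realFieldType) (eps : R) : 0 < eps < 1 / 3 ->
  (1 - 2 / 3 * eps)^-1 <= (1 + 22 * eps) ^+ 2.
Proof.
move=> /andP[eps_gt0 eps_lt]; rewrite -div1r ler_pdivrMr; last by lra.
have -> : (1 + 22 * eps) ^+ 2 * (1 - 2 / 3 * eps)
  = 1 + eps * (44 - 2 / 3 + eps * (484 - 88 / 3 - 968 / 3 * eps)) by field.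
rewrite lerDl; apply: mulr_ge0; first exact: ltW.
apply: addr_ge0; first by lra.
by apply: mulr_ge0; [exact: ltW | lra].
Qed.

Lemma solution_constant_le (R : rcfType) (eps : R) : 0 < eps < 1 / 3 ->
  2 / 3 * eps / (1 - 2 / 3 * eps) <= (1 - Num.sqrt eps) / (4 * eps).
Proof.
move=> /andP[eps_gt0 eps_lt]; rewrite ler_pdivrMr; last by lra.
rewrite [leRHS]mulrAC ler_pdivlMr; last by lra.
have s_ge0 := sqrtr_ge0 eps; have sE : Num.sqrt eps ^+ 2 = eps by rewrite sqr_sqrtr // ltW.
set s := Num.sqrt eps in s_ge0 sE *.
have s_le : s <= 578 / 1000 by rewrite leNgt; apply/negP => s_gt; nra.
have rhs_ge : 422 / 1000 * (7 / 9) <= (1 - s) * (1 - 2 / 3 * eps) by apply: ler_pM; lra.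
have eps_sqr_le : eps * eps <= 1 / 3 * (1 / 3) by apply: ler_pM; lra.
lra.
Qed.

Theorem theorem3p1 (R : realType) (p n r : nat)
    (A : 'M[R]_(2 ^ p, n)) (b : 'cV[R]_(2 ^ p)) (eps delta C : R)
    (hn : (0 < n)%N) (hmn : (n <= 2 ^ p)%N) (hA : \rank A = n)
    (heps : 0 < eps < 1 / 3) (hdelta : 0 < delta < 1) (hC : 1 <= C)
    (hr : 6 * C ^+ 2 * eps^-1
          * (Num.sqrt n%:R + Num.sqrt (8 * ln ((2 ^ p)%:R / delta))) ^+ 2
          * ln (n%:R / delta) <= r%:R)
    (hrm : (r <= 2 ^ p)%N) :
  let x_opt := pseudoinverse A *m b in
  let x_tilde := fun w : srht_outcome r (2 ^ p) =>
    pseudoinverse (srht R w *m A) *m (srht R w *m b) in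
  let q := 1 - delta `^ (C ^+ 2 * ln (n%:R / delta) / 4) - 7 * delta in
  q <= srht_prob R (fun w : srht_outcome r (2 ^ p) =>
         norm2 (A *m x_tilde w - b)
           <= (1 + 22 * eps) * norm2 (A *m x_opt - b))
  /\
  (forall (U : 'M[R]_(2 ^ p, n)) (gamma : R),
     left_singular_vectors A U ->
     0 < gamma <= 1 ->
     norm2 (U *m U^T *m b) = gamma * norm2 b ->
     q <= srht_prob R (fun w : srht_outcome r (2 ^ p) =>
            norm2 (x_opt - x_tilde w)
              <= Num.sqrt ((1 - Num.sqrt eps) / (4 * eps)) * cond2 A
                 * Num.sqrt (gamma ^- 2 - 1) * norm2 x_opt)).
Proof.
move=> x_opt x_tilde q; have := powR_ge0 delta (C ^+ 2 * ln (n%:R / delta) / 4).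
have [delta_gt|delta_le] := ltP (1 / 7) delta => pow_ge0.
  have q_le0 : q <= 0 by rewrite /q; lra.
  by split=> [|U gamma _ _ _]; exact: le_trans q_le0 (srht_prob_ge0 _ _).
have delta_bound : 0 < delta <= 1 / 7 by rewrite delta_le andbT; case/andP: hdelta.
have q_le : q <= 1 - 5 * delta by rewrite /q; lra.
have [d [W [TA [tb [orthW AE bE fail_le]]]]] :=
  exists_srht_embedding b hn hA heps delta_bound hC hr hrm.
have [eps_gt0 eps_lt] := andP heps; set eta := Num.sqrt (2 / 3 * eps) in fail_le.
have eta_sqr : eta ^+ 2 = 2 / 3 * eps by rewrite sqr_sqrtr //; lra.
have eta_bound : 0 < eta < 1.
  by rewrite -(expr_lt1 (n := 2)) ?sqrtr_ge0 // eta_sqr sqrtr_gt0; apply/andP; split; lra.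
split=> [|U gamma svU gamma_bound norm_proj];
  apply: (le_trans q_le); apply: (srht_prob_ge_onem hrm _ fail_le) => w /negPn/asboolP near_iso.
- apply: (norm2_sketch_residual_le orthW AE bE eta_bound near_iso); first by lra.
  by rewrite eta_sqr; exact: residual_constant_le.
- apply: (norm2_sketch_solution_le orthW AE bE eta_bound near_iso hA svU gamma_bound norm_proj).
  by rewrite eta_sqr; exact: solution_constant_le.
Qed.
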